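(* Let $(A,\mathfrak m)$ be a Noetherian local ring, $B$ a commutative ring with unity, $f:A\to B$ a ring homomorphism, and $J$ an ideal of $B$ contained in the Jacobson radical of $B$ such that $J$ is a finitely generated $A$-module (via $f$). Then $A\bowtie^f J$ is Cohen-Macaulay if and only if $A$ is Cohen-Macaulay and $J$ is a maximal Cohen-Macaulay $A$-module.
   Context: For a ring homomorphism $f:A\to B$ of commutative rings and an ideal $J$ of $B$, the amalgamation is the subring $A\bowtie^f J:=\{(a,f(a)+j)\mid a\in A,\ j\in J\}$ of $A\times B$. The ideal $J$ is regarded as an $A$-module via $f$. If $A$ is Noetherian and $J$ is finitely generated over $A$, then $A\bowtie^f J$ is Noetherian; it is local when $A$ is local and $J$ is contained in the Jacobson radical of $B$. A finitely generated module $M$ over a Noetherian local ring $(A,\mathfrak m)$ is called maximal Cohen-Macaulay if $\operatorname{depth} M=\dim A$, where $\operatorname{depth} M:=\inf\{i\mid H^i_{\mathfrak m}(M)\ne 0\}$ and $H^i_{\mathfrak m}$ denotes local cohomology with respect to $\mathfrak m$.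
   Formalization: The ideal J is assumed nonzero: for J = 0 and A a field, the amalgamation is isomorphic to A and so Cohen-Macaulay, while the zero module has depth +∞ and is not maximal Cohen-Macaulay, so the claim as written fails there. *)

(* Defs.v *)
From HB Require Import structures.
From mathcomp Require Import all_boot all_order all_algebra.
From mathcomp Require Import boolp classical_sets constructive_ereal.

Set Implicit Arguments.
Unset Strict Implicit.
Unset Printing Implicit Defensive.

Import Order.TTheory GRing.Theory Num.Theory.

Local Open Scope classical_set_scope.
Local Open Scope ring_scope.

(* The ideals of MathComp's ring_quotient are proper by definition, so they
   cannot be used here, e.g. to say that every ideal is finitely generated. *)
Definition is_ideal (R : comPzRingType) (I : set R) : Prop :=
  [/\ I 0, forall x y, I x -> I y -> I (x + y) & forall a x, I x -> I (a * x)].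

Record ideal (R : comPzRingType) := Ideal {
  ideal_set :> set R;
  idealP : is_ideal ideal_set
}.

Section Rings.
Variable R : comPzRingType.

Definition generated_ideal (n : nat) (g : 'I_n -> R) : set R :=
  [set x | exists c : 'I_n -> R, x = \sum_(i < n) c i * g i].

Definition noetherian : Prop :=
  forall I : set R, is_ideal I ->
    exists (n : nat) (g : 'I_n -> R), I = generated_ideal g.

Definition prime_ideal (P : set R) : Prop :=
  [/\ is_ideal P, ~ P 1 & forall x y, P (x * y) -> P x \/ P y].

Definition maximal_ideal (m : set R) : Prop :=
  [/\ is_ideal m, ~ m 1 &
    forall I : set R, is_ideal I -> m `<=` I -> ~ I 1 -> I = m].

Definition jacobson_radical : set R :=
  [set x | forall m : set R, maximal_ideal m -> m x].

Definition local_ring (m : set R) : Prop :=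
  maximal_ideal m /\ (forall m' : set R, maximal_ideal m' -> m' = m).

Definition prime_chain (n : nat) (P : nat -> set R) : Prop :=
  (forall i, (i <= n)%N -> prime_ideal (P i)) /\
  (forall i, (i < n)%N -> P i `<` P i.+1).

(* The supremum is taken in the extended integers, so that it can be infinite;
   it is -oo for the zero ring, which has no prime ideal. *)
Definition krull_dim : \bar int :=
  supremum -oo%E [set n%:Z%:E%E | n in [set n | exists P, prime_chain n P]].

(* The coefficients [a j] make the zeroth power the unit ideal. *)
Definition ideal_power (I : set R) (n : nat) : set R :=
  [set x | exists (k : nat) (a : 'I_k -> R) (y : 'I_k -> 'I_n -> R),
     (forall j i, I (y j i)) /\ x = \sum_(j < k) a j * \prod_(i < n) y j i].

End Rings.

Arguments jacobson_radical : clear implicits.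

Section LocalCohomology.
Variable R : comPzRingType.

Definition finitely_generated (M : lmodType R) : Prop :=
  exists (n : nat) (g : 'I_n -> M),
    forall x : M, exists c : 'I_n -> R, x = \sum_(i < n) c i *: g i.

Definition injective_module (E : lmodType R) : Prop :=
  forall (N N' : lmodType R) (u : {linear N -> N'}) (g : {linear N -> E}),
    injective u -> exists h : {linear N' -> E}, forall x, h (u x) = g x.

Record injective_resolution (M : lmodType R) := InjectiveResolution {
  res_obj : nat -> lmodType R;
  res_aug : {linear M -> res_obj 0};
  res_diff : forall n, {linear res_obj n -> res_obj n.+1};
  res_injective : forall n, injective_module (res_obj n);
  res_aug_inj : injective res_aug;
  res_exact0 : range res_aug = [set x | res_diff 0 x = 0];
  res_exactS : forall n,
    range (res_diff n) = [set x | res_diff n.+1 x = 0]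
}.

Arguments res_obj {M} _ _.
Arguments res_diff {M} _ _.

Variable m : set R.

(* The m-torsion functor; it acts on linear maps by restriction. *)
Definition torsion (M : lmodType R) : set M :=
  [set x | exists n : nat, forall a, ideal_power m n a -> a *: x = 0].
Arguments torsion : clear implicits.

Definition torsion_cocycles (M : lmodType R) (E : injective_resolution M)
    (i : nat) : set (res_obj E i) :=
  [set x | torsion (res_obj E i) x /\ res_diff E i x = 0].

Definition torsion_coboundaries (M : lmodType R) (E : injective_resolution M)
    (i : nat) : set (res_obj E i) :=
  match i with
  | 0 => [set 0]
  | k.+1 => res_diff E k @` torsion (res_obj E k)
  end.

Arguments torsion_cocycles {M} E i.
Arguments torsion_coboundaries {M} E i.

(* H^i_m(M) <> 0, where H^i_m is the i-th right derived functor of the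
   m-torsion functor: H^i_m(M) is the quotient of the cocycles by the
   coboundaries for an injective resolution of M, up to an isomorphism that
   depends on the resolution. *)
Definition local_cohomology_neq0 (M : lmodType R) (i : nat) : Prop :=
  exists E : injective_resolution M,
    ~ (torsion_cocycles E i `<=` torsion_coboundaries E i).

(* The infimum is +oo when no local cohomology module is nonzero,
   in particular when M = 0. *)
Definition depth (M : lmodType R) : \bar int :=
  infimum +oo%E [set i%:Z%:E%E | i in [set i | local_cohomology_neq0 M i]].

Definition maximal_cohen_macaulay (M : lmodType R) : Prop :=
  finitely_generated M /\ depth M = krull_dim R.

End LocalCohomology.

Definition cohen_macaulay (R : comPzRingType) : Prop :=
  noetherian R /\
  exists m : set R, local_ring m /\ depth m (R^o : lmodType R) = krull_dim R.

Section Ideals.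
Variables (R : comPzRingType) (I : ideal R).

Lemma ideal0 : ideal_set I 0. Proof. by have [] := idealP I. Qed.

Lemma idealD x y : ideal_set I x -> ideal_set I y -> ideal_set I (x + y).
Proof. by have [_ + _] := idealP I; apply. Qed.

Lemma idealMl a x : ideal_set I x -> ideal_set I (a * x).
Proof. by have [_ _] := idealP I; apply. Qed.

Lemma idealMr a x : ideal_set I x -> ideal_set I (x * a).
Proof. by rewrite mulrC; exact: idealMl. Qed.

Lemma idealN x : ideal_set I x -> ideal_set I (- x).
Proof. by rewrite -mulN1r; exact: idealMl. Qed.

End Ideals.

Section Amalgamation.
Variables (A B : comPzRingType) (f : {rmorphism A -> B}) (J : ideal B).

Definition amalgamation_pred : {pred A * B} :=
  [pred x | `[< exists (a : A) (j : B), ideal_set J j /\ x = (a, f a + j) >]].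

Lemma amalgamation_subring : subring_closed amalgamation_pred.
Proof.
split.
- by apply/asboolP; exists 1, 0; split; [exact: ideal0|rewrite rmorph1 addr0].
- move=> _ _ /asboolP[a [j [Jj ->]]] /asboolP[b [k [Jk ->]]].
  apply/asboolP; exists (a - b), (j - k); split.
    by apply: idealD => //; exact: idealN.
  by congr (_, _); rewrite /= rmorphB opprD addrACA.
- move=> _ _ /asboolP[a [j [Jj ->]]] /asboolP[b [k [Jk ->]]].
  apply/asboolP; exists (a * b), (f a * k + j * (f b + k)); split.
    by apply: idealD; [exact: idealMl|exact: idealMr].
  by congr (_, _); rewrite /= rmorphM mulrDl mulrDr addrA.
Qed.

(* The subring of A * B usually written with a bowtie. *)
Record amalgamation := Amalgamation {
  amalgamation_val :> A * B;
  amalgamation_valP : amalgamation_val \in amalgamation_pred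
}.

HB.instance Definition _ := [isSub for amalgamation_val].
HB.instance Definition _ := [Choice of amalgamation by <:].
HB.instance Definition _ :=
  GRing.SubChoice_isSubComPzRing.Build (A * B)%type _ amalgamation
    amalgamation_subring.

End Amalgamation.

Section IdealElements.
Variables (B : comPzRingType) (J : ideal B).

Definition ideal_pred : {pred B} := [pred x | `[< ideal_set J x >]].

Lemma ideal_zmod : zmod_closed ideal_pred.
Proof.
split; first by apply/asboolP; exact: ideal0.
move=> x y /asboolP Jx /asboolP Jy; apply/asboolP.
by apply: idealD => //; exact: idealN.
Qed.

Record ideal_elt := IdealElt {
  ideal_elt_val :> B;
  ideal_elt_valP : ideal_elt_val \in ideal_pred
}.

HB.instance Definition _ := [isSub for ideal_elt_val].
HB.instance Definition _ := [Choice of ideal_elt by <:].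
HB.instance Definition _ :=
  GRing.SubChoice_isSubZmodule.Build B _ ideal_elt ideal_zmod.

End IdealElements.

(* J regarded as an A-module via f: a copy of the elements of J that mentions f,
   since the A-module structure depends on f. *)
Definition ideal_module (A B : comPzRingType) (f : {rmorphism A -> B})
  (J : ideal B) : Type := ideal_elt J.

Section IdealModule.
Variables (A B : comPzRingType) (f : {rmorphism A -> B}) (J : ideal B).

Local Notation M := (ideal_module f J).

HB.instance Definition _ := GRing.Zmodule.copy M (ideal_elt J).

Lemma ideal_module_scale_subproof (a : A) (x : ideal_elt J) :
  f a * val x \in ideal_pred J.
Proof. by case: x => b /= /asboolP Jb; apply/asboolP; exact: idealMl. Qed.

Definition ideal_module_scale (a : A) (x : M) : M :=
  IdealElt (ideal_module_scale_subproof a x).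

Lemma ideal_module_scaleA a b x :
  ideal_module_scale a (ideal_module_scale b x) = ideal_module_scale (a * b) x.
Proof. by apply: val_inj; rewrite /= rmorphM mulrA. Qed.

Lemma ideal_module_scale1 : left_id 1 ideal_module_scale.
Proof. by move=> x; apply: val_inj; rewrite /= rmorph1 mul1r. Qed.

Lemma ideal_module_scaleDr : right_distributive ideal_module_scale +%R.
Proof. by move=> a x y; apply: val_inj; rewrite /= mulrDr. Qed.

Lemma ideal_module_scaleDl x :
  {morph ideal_module_scale^~ x : a b / a + b}.
Proof. by move=> a b; apply: val_inj; rewrite /= rmorphD mulrDl. Qed.

HB.instance Definition _ := GRing.Zmodule_isLmodule.Build A M
  ideal_module_scaleA ideal_module_scale1 ideal_module_scaleDr
  ideal_module_scaleDl.

End IdealModule.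

(* Main.v *)
(* Write R for the amalgamation.  The A-module R is the direct sum of A and J,
   and its maximal ideal is nilpotent modulo the extension of m.  The whole proof
   rests on one fact about local cohomology: if x in m is regular on M, then
   H^i_m(M) = 0 for all i <= n if and only if H^i_m(M/xM) = 0 for all i < n.
   Since a noetherian module M with H^0_m(M) = 0 has a regular element in m,
   induction on n gives both
   - depth R = min (depth A, depth J), because an element of m that is regular on
     the A-module A + J is regular on R, on A and on J; and
   - depth M <= dim A for M <> 0, because an associated prime of M is strictly
     contained in an associated prime of M/xM, so that the vanishing of H^i_m(M)
     for i < n provides a chain of primes of length n.
   Moreover dim R = dim A, by incomparability in the integral extension A -> R and
   by the surjection R -> A.  Hence each of the two conditions says that
   H^i_m(A) = H^i_m(J) = 0 for all i < dim A. *)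

Require Import Defs.
From HB Require Import structures.
From mathcomp Require Import all_boot all_order all_algebra.
From mathcomp Require Import boolp classical_sets functions constructive_ereal.

Set Implicit Arguments.
Unset Strict Implicit.
Unset Printing Implicit Defensive.

Import Order.TTheory GRing.Theory Num.Theory.

Local Open Scope classical_set_scope.
Local Open Scope ring_scope.

(** * Quotient modules *)

(** Nonvanishing of H^i_m(M) is the existence of a resolution with a nonzero class, so its negation
    speaks of all injective resolutions at once. Hence resolutions must exist, which comes from the
    divisible group Q/Z, and vanishing must not depend on the one chosen. After that only the
    statement H^i_m(M) = 0 for all i < n is handled; no module H^i_m(M) is formed. The passage from
    M to M/xM needs a resolution of M/xM tied to one of M, and the mapping cone of x supplies it.
    Modules over A and over the amalgamation have unrelated injectives. The induction on n gets
    around this: dividing by a regular element lowers n on both sides, so that the two local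
    cohomologies are compared in degree 0 only, where they are torsion submodules. Chains of primes
    stand in for the dimension, so the argument never has to know whether dim A is finite. *)

Definition linear_of (R : pzRingType) (U V : lmodType R) (f : U -> V)
    (f_linear : linear f) : {linear U -> V} :=
  HB.pack f (GRing.isLinear.Build R U V *:%R f f_linear).

Definition is_submodule (R : pzRingType) (M : lmodType R) (S : set M) : Prop :=
  S 0 /\ forall a x y, S x -> S y -> S (a *: x + y).

Section Submodule.
Variables (R : pzRingType) (M : lmodType R) (S : set M).
Hypothesis S_submod : is_submodule S.

Lemma submodule0 : S 0. Proof. by case: S_submod. Qed.

Lemma submoduleD x y : S x -> S y -> S (x + y).
Proof. by case: S_submod => _ H Sx Sy; rewrite -[x]scale1r; apply: H. Qed.

Lemma submoduleZ a x : S x -> S (a *: x).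
Proof. by case: S_submod => S0 H Sx; rewrite -[_ *: _]addr0; apply: H. Qed.

Lemma submoduleN x : S x -> S (- x).
Proof. by rewrite -scaleN1r; apply: submoduleZ. Qed.

Lemma submoduleB x y : S x -> S y -> S (x - y).
Proof. by move=> Sx Sy; apply: submoduleD => //; apply: submoduleN. Qed.

End Submodule.

Record submodule (R : pzRingType) (M : lmodType R) := Submodule {
  submodule_set :> set M;
  submoduleP : is_submodule submodule_set
}.

Section QuotientModule.
Variables (R : pzRingType) (M : lmodType R) (S : submodule M).

Definition submodule_pred : {pred M} := [pred x | `[< submodule_set S x >]].

Lemma submodule_zmod : zmod_closed submodule_pred.
Proof.
split; first by apply/asboolP; apply: submodule0; apply: submoduleP.
move=> x y /asboolP Sx /asboolP Sy; apply/asboolP.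
by apply: submoduleB => //; apply: submoduleP.
Qed.

HB.instance Definition _ :=
  GRing.isZmodClosed.Build M submodule_pred submodule_zmod.

Definition quotient_module : Type := (Quotient.quot submodule_pred).

HB.instance Definition _ :=
  GRing.Zmodule.copy quotient_module (Quotient.quot submodule_pred).

Local Notation Q := quotient_module.
Local Open Scope quotient_scope.

Definition quotient_pi (x : M) : Q := \pi_(Quotient.quot submodule_pred) x.

Lemma quotient_pi_eq x y : quotient_pi x = quotient_pi y <-> submodule_set S (x - y).
Proof.
split=> [/eqP|Sxy].
  by rewrite /quotient_pi -Quotient.idealrBE => /asboolP.
by apply/eqP; rewrite /quotient_pi -Quotient.idealrBE; apply/asboolP.
Qed.

Lemma quotient_pi_surj (y : Q) : exists x, quotient_pi x = y.
Proof. by exists (repr y); apply: reprK. Qed.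

Lemma quotient_piD : {morph quotient_pi : x y / x + y}.
Proof. exact: raddfD. Qed.

Definition quotient_scale (a : R) (x : Q) : Q := quotient_pi (a *: repr x).

Lemma quotient_scaleE a x : quotient_scale a (quotient_pi x) = quotient_pi (a *: x).
Proof.
apply/quotient_pi_eq; rewrite -scalerBr; apply: submoduleZ (submoduleP S) _ _ _.
by apply/quotient_pi_eq; apply: reprK.
Qed.

Lemma quotient_scaleA a b x :
  quotient_scale a (quotient_scale b x) = quotient_scale (a * b) x.
Proof. by have [y <-] := quotient_pi_surj x; rewrite !quotient_scaleE scalerA. Qed.

Lemma quotient_scale1 : left_id 1 quotient_scale.
Proof.
by move=> x; have [y <-] := quotient_pi_surj x; rewrite quotient_scaleE scale1r.
Qed.

Lemma quotient_scaleDr : right_distributive quotient_scale +%R.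
Proof.
move=> a x y; have [x' <-] := quotient_pi_surj x.
have [y' <-] := quotient_pi_surj y.
by rewrite -quotient_piD !quotient_scaleE scalerDr quotient_piD.
Qed.

Lemma quotient_scaleDl x : {morph quotient_scale^~ x : a b / a + b}.
Proof.
move=> a b; have [x' <-] := quotient_pi_surj x.
by rewrite !quotient_scaleE scalerDl quotient_piD.
Qed.

HB.instance Definition _ := GRing.Zmodule_isLmodule.Build R Q
  quotient_scaleA quotient_scale1 quotient_scaleDr quotient_scaleDl.

Lemma quotient_pi_linear : linear quotient_pi.
Proof. by move=> a x y; rewrite quotient_piD -quotient_scaleE. Qed.

End QuotientModule.

(** Interface to quotients: what follows uses only a surjection with a prescribed kernel. *)
Lemma quotient_exists (R : pzRingType) (M : lmodType R) (S : set M) :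
  is_submodule S -> exists (Q : lmodType R) (pi : {linear M -> Q}),
    (forall y, exists x, pi x = y) /\ (forall x, pi x = 0 <-> S x).
Proof.
move=> S_submod; pose S' := Submodule S_submod.
exists (quotient_module S' : lmodType R), (linear_of (quotient_pi_linear S')).
split=> [y|x]; first by have [x <-] := quotient_pi_surj y; exists x.
have /= := quotient_pi_eq S' x 0; rewrite subr0 => <-.
have -> // : quotient_pi S' 0 = 0.
by apply: (addrI (quotient_pi S' 0)); rewrite -quotient_piD !addr0.
Qed.

Lemma linear_factor (R : pzRingType) (M Q E : lmodType R)
    (pi : {linear M -> Q}) (g : {linear M -> E}) :
  (forall y, exists x, pi x = y) -> (forall x, pi x = 0 -> g x = 0) ->
  exists h : {linear Q -> E}, forall x, h (pi x) = g x.
Proof.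
move=> pi_surj ker_le; pose s y := sval (cid (pi_surj y)).
have sK y : pi (s y) = y by rewrite /s; case: cid.
have gE x y : pi x = pi y -> g x = g y.
  by move=> e; apply/eqP; rewrite -subr_eq0 -linearB ker_le // linearB e subrr.
have lin : linear (g \o s).
  by move=> a x y /=; rewrite -linearP; apply: gE; rewrite linearP !sK.
by exists (linear_of lin) => x; apply: gE; rewrite sK.
Qed.

Lemma linear_inj (R : pzRingType) (M N : lmodType R) (u : {linear M -> N}) :
  (forall x, u x = 0 -> x = 0) -> injective u.
Proof.
move=> u_ker x y uxy; apply/eqP; rewrite -subr_eq0; apply/eqP/u_ker.
by rewrite linearB uxy subrr.
Qed.

Lemma zmod_morphism0 (U V : zmodType) (f : U -> V) :
  {morph f : x y / x - y} -> f 0 = 0.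
Proof. by move=> fB; rewrite -(subrr 0) fB subrr. Qed.

Lemma zmod_morphismD (U V : zmodType) (f : U -> V) :
  {morph f : x y / x - y} -> {morph f : x y / x + y}.
Proof.
move=> fB x y; rewrite -{1}[y]opprK fB -[- y]sub0r fB (zmod_morphism0 fB).
by rewrite sub0r opprK.
Qed.

(** * Enough injectives *)

Definition divisible (D : zmodType) : Prop :=
  forall n (d : D), (0 < n)%N -> exists e, e *+ n = d.

Section DivisibleExtension.
Variables (N D : zmodType).

(* The graph of an additive map defined on a subgroup of [N]. *)
Definition partial_hom (G : set (N * D)) : Prop :=
  [/\ G 0, forall p q, G p -> G q -> G (p - q) & forall d, G (0, d) -> d = 0].

Section PartialHom.
Variable G : set (N * D).
Hypothesis G_hom : partial_hom G.

Lemma partial_homN p : G p -> G (- p).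
Proof. by case: G_hom => G0 GB _ Gp; rewrite -sub0r; apply: GB. Qed.

Lemma partial_homD p q : G p -> G q -> G (p + q).
Proof.
by case: G_hom => _ GB _ Gp Gq; rewrite -[q]opprK; apply/GB/partial_homN.
Qed.

Lemma partial_homMn p n : G p -> G (p *+ n).
Proof.
move=> Gp; elim: n => [|n IHn]; first by case: G_hom.
by rewrite mulrS; apply: partial_homD.
Qed.

Lemma partial_hom_inj x d e : G (x, d) -> G (x, e) -> d = e.
Proof.
case: G_hom => _ GB G_inj Gd Ge; apply/eqP; rewrite -subr_eq0; apply/eqP.
by apply: G_inj; have := GB _ _ Gd Ge; rewrite -[_ - _]/(x - x, d - e) subrr.
Qed.

(** The integers k such that [x *~ k] lies in the domain of [G] form a subgroup. Divisibility lets
    the value at its least positive element n be divided by n; if the subgroup is trivial, 0 will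
    do. *)
Lemma partial_hom_value x : divisible D ->
  exists d, forall k e, G (x *~ k, e) -> e = d *~ k.
Proof.
move=> D_div.
suff [d dP] : exists d, forall k e, G (x *+ k, e) -> e = d *+ k.
  exists d => -[k|k] e /=; first exact: dP.
  move=> /partial_homN; rewrite -[- _]/(- (x *- k.+1), - e) opprK => /dP de.
  by rewrite -[e]opprK de.
have [[n [n_gt0 [e Gne]]]|no] :=
    pselect (exists n, (0 < n)%N /\ exists e, G (x *+ n, e)).
  have ex : exists n, `[< (0 < n)%N /\ exists e, G (x *+ n, e) >].
    by exists n; apply/asboolP; split=> //; exists e.
  case: (ex_minnP ex) => {n n_gt0 e Gne} n /asboolP[n_gt0 [e Gne]] n_min.
  have [d de] := D_div n e n_gt0; exists d => k e' Gke'.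
  (* The remainder of k modulo n stays in the subgroup, so minimality of n makes it 0. *)
  have Gr : G (x *+ (k %% n), e' - e *+ (k %/ n)).
    case: G_hom => _ GB _.
    have := GB _ _ Gke' (partial_homMn (k %/ n) Gne).
    have -> : (x *+ n, e) *+ (k %/ n) = (x *+ n *+ (k %/ n), e *+ (k %/ n)).
      by elim: (k %/ n)%N => // j IHj; rewrite !mulrS IHj.
    rewrite -[_ - _]/(_ - _, _ - _) /= -mulrnA {1}(divn_eq k n) mulrnDr mulnC.
    by rewrite addrAC subrr add0r.
  have r0 : (k %% n)%N = 0%N.
    apply/eqP; apply: contraLR (ltn_pmod k n_gt0); rewrite -lt0n -leqNgt => r_gt0.
    by apply: n_min; apply/asboolP; split=> //; eexists; apply: Gr.
  move: Gr; rewrite r0 mulr0n; case: G_hom => _ _ G_inj /G_inj/eqP.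
  by rewrite subr_eq0 -de -mulrnA mulnC {2}(divn_eq k n) r0 addn0 => /eqP.
exists 0 => k e Gke; case: k Gke => [|k] Gke.
  by case: G_hom => _ _; apply.
by case: no; exists k.+1; split=> //; exists e.
Qed.

End PartialHom.

(** Zorn's lemma on the partial maps extending [G]: a maximal one that misses x extends to x by
    [partial_hom_value]. This is the injectivity of divisible groups. *)
Lemma partial_hom_extend (G : set (N * D)) : divisible D -> partial_hom G ->
  exists h : N -> D, {morph h : x y / x + y} /\ forall x d, G (x, d) -> h x = d.
Proof.
move=> D_div G_hom.
(* [Zorn_bigcup] also tests the empty chain, whose union is empty; so the empty set is let in and
   excluded afterwards. *)
pose P X := X = set0 \/ (partial_hom X /\ G `<=` X).
have [F FP F_tot|X [PX X_max]] := @Zorn_bigcup _ P.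
  have [[X0 [FX0 X0_neq0]]|no] := pselect (exists X, F X /\ X <> set0); last first.
    left; rewrite predeqE => p; split=> // -[X FX Xp]; case: no; exists X; split=> // X0.
    by rewrite X0 in Xp.
  have good X : F X -> X <> set0 -> partial_hom X /\ G `<=` X.
    by move=> /FP[].
  have [[X00 X0B X0i] GX0] := good _ FX0 X0_neq0.
  right; split; last by move=> p /GX0 X0p; exists X0.
  split; first by exists X0.
    move=> p q [X FX Xp] [Y FY Yq].
    have [Z [FZ Zp Zq]] : exists Z, [/\ F Z, Z p & Z q].
      by case: (F_tot X Y FX FY) => H; [exists Y|exists X]; split=> //; apply: H.
    exists Z => //; have [|[_ ZB _] _] := good Z FZ; last exact: ZB.
    by move=> Z0; rewrite Z0 in Zp.
  move=> d [X FX Xd]; have [|[_ _ X_inj] _] := good X FX; last exact: X_inj.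
  by move=> X_0; rewrite X_0 in Xd.
have [X_hom GX] : partial_hom X /\ G `<=` X.
  case: PX => // X0; case: (X_max G); last by rewrite /P; right; split.
  rewrite X0; split; first by move=> p [].
  by case: G_hom => G0 _ _ /(_ 0 G0).
have X_total x : exists d, X (x, d).
  apply: contrapT => no; have [d dP] := partial_hom_value X_hom x D_div.
  (* The graph [X] plus the multiples of (x, d); the choice of d keeps it single-valued. *)
  pose Y : set (N * D) := [set p | exists k, X (p.1 - x *~ k, p.2 - d *~ k)].
  case: (X_max Y); last first.
    right; split; last by move=> p /GX Xp; exists 0; rewrite !subr0; case: p Xp.
    split; first by exists 0; rewrite !subr0; case: X_hom.
      move=> p q [k Xk] [l Xl]; exists (k - l).
      have [_ XB _] := X_hom; have := XB _ _ Xk Xl.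
      rewrite -[T in X T]/(_ - _, _ - _) /= !mulrzBr.
      have BB (T : zmodType) (a b c d' : T) : a - b - (c - d') = a - c - (b - d').
        by rewrite opprD addrACA -opprD.
      by rewrite !(BB _ _ (_ *~ _)).
    move=> e [k] /=; rewrite sub0r => /(partial_homN X_hom).
    rewrite -[T in X T]/(- _, - _) /= opprK opprB => /dP de.
    by apply/eqP; rewrite -oppr_eq0 -(inj_eq (addrI (d *~ k))) addr0; apply/eqP.
  split.
    by move=> p Xp; exists 0; rewrite !subr0; case: p Xp.
  move=> YX; apply: no; exists d; apply: YX; exists 1; rewrite /= !subrr.
  by case: X_hom.
pose h x := sval (cid (X_total x)).
have hP x : X (x, h x) by rewrite /h; case: cid.
exists h; split=> [x y|x d /GX Xd]; last exact: partial_hom_inj (hP x) Xd.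
by apply: partial_hom_inj (hP _) _ => //; apply: (partial_homD X_hom (hP x) (hP y)).
Qed.

End DivisibleExtension.

(* The witness is [Q/Z]. *)
Lemma divisible_torsion_exists : exists D : zmodType,
  divisible D /\ forall n, (1 < n)%N -> exists2 c : D, c <> 0 & c *+ n = 0.
Proof.
pose V : lmodType int := zmodule rat.
pose S : set V := [set x : V | (x : rat) \in Num.int].
have S_submod : is_submodule S.
  split; first exact: rpred0.
  move=> a x y Sx Sy; rewrite /S /=.
  have -> : (a *: x + y : V) = ((x : rat) *~ a + (y : rat) :> rat) by [].
  by rewrite rpredD ?rpredMz.
have [Q [pi [pi_surj pi_ker]]] := quotient_exists S_submod.
exists Q; split=> [n d n_gt0|n n_gt1].
  have [x <-] := pi_surj d; exists (pi ((x : rat) / n%:R)).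
  rewrite -raddfMn; congr (pi _).
  have -> : (((x : rat) / n%:R : V) *+ n) = ((x : rat) / n%:R *+ n :> rat) by [].
  by rewrite -[_ / _ *+ n]mulr_natr divfK // pnatr_eq0 -lt0n.
have n_neq0 : n%:R != 0 :> rat by rewrite pnatr_eq0 -lt0n ltnW.
exists (pi (n%:R^-1 : rat)).
  move=> /pi_ker; rewrite /S /= => /intrP[k nk].
  have : 1 = k%:~R * n%:R :> rat by rewrite -nk mulVf.
  have -> : n%:R = n%:~R :> rat by [].
  rewrite -intrM -[1]/(1%:~R) => /intr_inj.
  move=> /(congr1 absz); rewrite abszM => /esym/eqP.
  by rewrite muln_eq1 => /andP[_ /eqP /= n1]; rewrite n1 in n_gt1.
rewrite -raddfMn; apply/pi_ker; rewrite /S /=.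
have -> : ((n%:R^-1 : rat) : V) *+ n = (n%:R^-1 *+ n :> rat) by [].
by rewrite -[_ *+ n]mulr_natr mulVf.
Qed.

(* The R-module [Hom_Z(R, D)]. *)
Section Coinduced.
Variables (R : comPzRingType) (D : zmodType).

Definition additive_pred : {pred (R -> D)} :=
  [pred f | `[< {morph f : x y / x + y} >]].

Lemma additive_zmod : zmod_closed additive_pred.
Proof.
split; first by apply/asboolP => x y; rewrite addr0.
move=> f g /asboolP fD /asboolP gD; apply/asboolP => x y.
by rewrite !fctE fD gD opprD addrACA.
Qed.

Record coinduced := Coinduced {
  coinduced_val :> R -> D;
  coinduced_valP : coinduced_val \in additive_pred
}.

HB.instance Definition _ := [isSub for coinduced_val].
HB.instance Definition _ := [Choice of coinduced by <:].
HB.instance Definition _ :=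
  GRing.SubChoice_isSubZmodule.Build (R -> D) _ coinduced additive_zmod.

Lemma coinducedD (f : coinduced) : {morph coinduced_val f : x y / x + y}.
Proof. by case: f => f /= /asboolP. Qed.

Lemma coinduced_scale_subproof (a : R) (f : coinduced) :
  (fun x => coinduced_val f (x * a)) \in additive_pred.
Proof. by apply/asboolP => x y; rewrite mulrDl coinducedD. Qed.

Definition coinduced_scale a f : coinduced :=
  Coinduced (coinduced_scale_subproof a f).

Lemma coinduced_scaleA a b f :
  coinduced_scale a (coinduced_scale b f) = coinduced_scale (a * b) f.
Proof. by apply: val_inj; apply/funext => x /=; rewrite mulrA. Qed.

Lemma coinduced_scale1 : left_id 1 coinduced_scale.
Proof. by move=> f; apply: val_inj; apply/funext => x /=; rewrite mulr1. Qed.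

Lemma coinduced_scaleDr : right_distributive coinduced_scale +%R.
Proof. by move=> a f g; apply: val_inj; apply/funext. Qed.

Lemma coinduced_scaleDl f : {morph coinduced_scale^~ f : a b / a + b}.
Proof.
move=> a b; apply: val_inj; apply/funext => x /=.
by rewrite mulrDr coinducedD.
Qed.

HB.instance Definition _ := GRing.Zmodule_isLmodule.Build R coinduced
  coinduced_scaleA coinduced_scale1 coinduced_scaleDr coinduced_scaleDl.

End Coinduced.

(** Evaluation at 1 identifies linear maps into Hom_Z(R, D) with additive maps into D, and the
    latter extend because D is divisible. *)
Lemma injective_coinduced (R : comPzRingType) (D : zmodType) :
  divisible D -> injective_module (coinduced R D : lmodType R).
Proof.
move=> D_div N N' u g u_inj.
pose G : set (N' * D) := [set p | exists x, u x = p.1 /\ coinduced_val (g x) 1 = p.2].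
have [] := @partial_hom_extend N' D G D_div.
  split; first by exists 0; rewrite !linear0.
    move=> p q [x [xp1 xp2]] [y [yq1 yq2]]; exists (x - y).
    by rewrite !linearB xp1 yq1 /= -xp2 -yq2.
  by move=> d [x [/= ux0 <-]]; rewrite (u_inj x 0) ?linear0.
move=> h [hD hG].
have h_add (y : N') : (fun a : R => h (a *: y)) \in @additive_pred R D.
  by apply/asboolP => a b; rewrite scalerDl hD.
pose k (y : N') : coinduced R D := Coinduced (h_add y).
have k_lin : linear k.
  move=> a x y; apply: val_inj; apply/funext => b /=.
  by rewrite -[RHS]/(h ((b * a) *: x) + h (b *: y)) scalerDr scalerA hD.
exists (linear_of k_lin) => x; apply: val_inj; apply/funext => a /=.
apply: hG; exists (a *: x); rewrite !linearZ; split=> //=.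
by rewrite /= mul1r.
Qed.

(** With [C] the set of all additive maps from M to D, x is sent to a |-> (c |-> c (a x)). This is
    injective as soon as every nonzero z is detected by some c. *)
Lemma enough_injectives (R : comPzRingType) (M : lmodType R) :
  exists (E : lmodType R) (u : {linear M -> E}),
    injective_module E /\ injective u.
Proof.
have [D [D_div D_tors]] := divisible_torsion_exists.
pose C := {f : M -> D | {morph f : x y / x + y}}.
pose D' : zmodType := C -> D.
have D'_div : divisible D'.
  move=> n d n_gt0; exists (fun c => sval (cid (D_div n (d c) n_gt0))).
  have MnE (e : D') k c : (e *+ k) c = e c *+ k.
    by elim: k => // k IHk; rewrite !mulrS -IHk.
  by apply/funext => c; rewrite MnE; case: cid.
have u_add (x : M) : (fun (a : R) (c : C) => sval c (a *: x)) \in @additive_pred R D'.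
  by apply/asboolP => a b; apply/funext => c; rewrite scalerDl (svalP c).
pose u (x : M) : coinduced R D' := Coinduced (u_add x).
have u_lin : linear u.
  move=> a x y; apply: val_inj; apply/funext => b /=; apply/funext => c.
  rewrite -[RHS]/(sval c ((b * a) *: x) + sval c (b *: y)).
  by rewrite scalerDr scalerA (svalP c).
exists (coinduced R D'), (linear_of u_lin); split; first exact: injective_coinduced.
apply: linear_inj => z uz0; apply: contrapT => z_neq0.
(* A nonzero image for z whose order divides that of z, or any nonzero element if z has infinite
   order. The multiples of z then map to D, and this map extends to M. *)
have [c c_neq0 c_ord] : exists2 c : D, c <> 0 & forall k, z *~ k = 0 -> c *~ k = 0.
  have [[n [n_gt0 zn]]|no] := pselect (exists n, (0 < n)%N /\ z *+ n = 0); last first.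
    have [c c_neq0 _] := D_tors 2%N isT; exists c => // -[[|k]|k] zk //.
      by case: no; exists k.+1.
    by case: no; exists k.+1; split=> //; apply/eqP; rewrite -oppr_eq0; apply/eqP.
  have ex : exists n, (0 < n)%N && (z *+ n == 0).
    by exists n; rewrite n_gt0 zn eqxx.
  case: (ex_minnP ex) => {n n_gt0 zn} n /andP[n_gt0 /eqP zn] n_min.
  have n_gt1 : (1 < n)%N.
    by case: n n_gt0 zn {n_min} => [|[|n]] //; rewrite mulr1n.
  have [c c_neq0 cn] := D_tors n n_gt1; exists c => //.
  suff cP k : z *+ k = 0 -> c *+ k = 0.
    case=> k /= zk; first exact: cP.
    rewrite -[c *~ _]/(- (c *+ k.+1)) cP ?oppr0 //.
    by apply/eqP; rewrite -oppr_eq0; apply/eqP.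
  have kE (T : zmodType) (t : T) : t *+ n = 0 -> t *+ k = t *+ (k %% n).
    by move=> tn; rewrite {1}(divn_eq k n) mulrnDr mulnC mulrnA tn mul0rn add0r.
  rewrite !kE // => zr.
  have [-> //|r_gt0] := posnP (k %% n).
  have := ltn_pmod k n_gt0; rewrite ltnNge n_min //.
  by rewrite r_gt0 zr eqxx.
pose G : set (M * D) := [set p | exists k, p = (z *~ k, c *~ k)].
have [] := @partial_hom_extend M D G D_div.
  split; first by exists 0.
    by move=> p q [k ->] [l ->]; exists (k - l); rewrite !mulrzBr.
  by move=> d [k [zk ->]]; apply: c_ord.
move=> h [hD hG]; apply: c_neq0; rewrite -(hG z c); last by exists 1.
have := congr1 (fun f : coinduced R D' => coinduced_val f 1 (exist _ h hD)) uz0.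
by rewrite /= scale1r.
Qed.

(** * Injective resolutions and local cohomology *)

Record cosyzygy (R : comPzRingType) (M : lmodType R) := Cosyzygy {
  cosyzygy_hull : lmodType R;
  cosyzygy_emb : {linear M -> cosyzygy_hull};
  cosyzygy_coker : lmodType R;
  cosyzygy_pi : {linear cosyzygy_hull -> cosyzygy_coker};
  cosyzygy_injective : injective_module cosyzygy_hull;
  cosyzygy_emb_inj : injective cosyzygy_emb;
  cosyzygy_pi_surj : forall y, exists x, cosyzygy_pi x = y;
  cosyzygy_pi_ker : forall x, cosyzygy_pi x = 0 <-> range cosyzygy_emb x
}.

Lemma range_submodule (R : pzRingType) (M N : lmodType R) (u : {linear M -> N}) :
  is_submodule (range u).
Proof.
split; first by exists 0; rewrite ?linear0.
by move=> a _ _ [x _ <-] [y _ <-]; exists (a *: x + y); rewrite ?linearP.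
Qed.

Lemma ker_submodule (R : pzRingType) (M N : lmodType R) (u : {linear M -> N}) :
  is_submodule [set x | u x = 0].
Proof.
split; first exact: linear0.
by move=> a x y /= ux uy; rewrite linearP ux uy scaler0 addr0.
Qed.

Definition cosyzygy_of (R : comPzRingType) (M : lmodType R) : cosyzygy M.
Proof.
have [E /cid[u [E_inj u_inj]]] := cid (enough_injectives M).
have [Q /cid[pi [pi_surj pi_ker]]] := cid (quotient_exists (range_submodule u)).
exact: (@Cosyzygy R M E u Q pi).
Qed.

Lemma resolution_exists (R : comPzRingType) (M : lmodType R) :
  inhabited (injective_resolution M).
Proof.
pose syz := fix syz n : lmodType R :=
  if n is k.+1 then cosyzygy_coker (cosyzygy_of (syz k)) else M.
pose C n := cosyzygy_of (syz n).
pose d n : {linear cosyzygy_hull (C n) -> cosyzygy_hull (C n.+1)} :=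
  cosyzygy_emb (C n.+1) \o cosyzygy_pi (C n).
have d_ker n : [set x | d n x = 0] = range (cosyzygy_emb (C n)).
  rewrite predeqE => x; rewrite -cosyzygy_pi_ker /d /=; split=> [|->]; last exact: linear0.
  by rewrite -[X in _ = X](linear0 (cosyzygy_emb (C n.+1))) => /cosyzygy_emb_inj.
apply: inhabits; apply: (@InjectiveResolution R M _ (cosyzygy_emb (C 0%N)) d).
- by move=> n; apply: cosyzygy_injective.
- exact: cosyzygy_emb_inj.
- by rewrite d_ker.
move=> n; rewrite d_ker predeqE => y; split=> -[x _ <-].
  by exists (cosyzygy_pi (C n) x).
by have [z <-] := cosyzygy_pi_surj x; exists z.
Qed.

(** Replacing N by N/ker u removes the injectivity requirement on u, so that the extension property
    applies to the differentials of a resolution. *)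
Lemma injective_extend (R : comPzRingType) (N N' E : lmodType R)
    (u : {linear N -> N'}) (g : {linear N -> E}) :
  injective_module E -> (forall x, u x = 0 -> g x = 0) ->
  exists h : {linear N' -> E}, forall x, h (u x) = g x.
Proof.
move=> E_inj ker_le.
have [Q [pi [pi_surj pi_ker]]] := quotient_exists (ker_submodule u).
have [u' u'E] := @linear_factor _ _ _ _ pi u pi_surj (fun x => (pi_ker x).1).
have [g' g'E] : exists g' : {linear Q -> E}, forall x, g' (pi x) = g x.
  by apply: linear_factor => // x /pi_ker/ker_le.
have [|h hE] := E_inj _ _ u' g'.
  apply: linear_inj => y; have [x <-] := pi_surj y.
  by rewrite u'E => ux; apply/pi_ker.
by exists h => x; rewrite -u'E hE g'E.
Qed.

Section Comparison.
Variables (R : comPzRingType) (X Y : nat -> lmodType R).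
Variable dX : forall n, {linear X n -> X n.+1}.
Variable dY : forall n, {linear Y n -> Y n.+1}.
Hypothesis X_exact : forall n x, dX n.+1 x = 0 -> exists y, dX n y = x.
Hypothesis X_complex : forall n x, dX n.+1 (dX n x) = 0.
Hypothesis Y_complex : forall n y, dY n.+1 (dY n y) = 0.
Hypothesis Y_injective : forall n, injective_module (Y n).

Lemma chain_map_exists (f0 : {linear X 0%N -> Y 0%N}) :
  (forall x, dX 0%N x = 0 -> dY 0%N (f0 x) = 0) ->
  exists f : forall n, {linear X n -> Y n},
    f 0%N = f0 /\ forall n x, f n.+1 (dX n x) = dY n (f n x).
Proof.
move=> f0_cocycle.
(* The cocycle condition travels with each component, since it is what allows the next extension
   along [dX n]. *)
pose T n := {f : {linear X n -> Y n} | forall x, dX n x = 0 -> dY n (f x) = 0}.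
have step n (f : T n) : {g : T n.+1 | forall x, sval g (dX n x) = dY n (sval f x)}.
  apply: cid; case: f => f f_cocycle /=.
  have [g gE] := @injective_extend _ _ _ _ (dX n) (dY n \o f)
    (Y_injective (n := n.+1)) f_cocycle.
  have g_cocycle x : dX n.+1 x = 0 -> dY n.+1 (g x) = 0.
    by move=> /X_exact[y <-]; rewrite gE /= Y_complex.
  by exists (exist _ g g_cocycle).
pose F := fix F n : T n :=
  if n is k.+1 then sval (step k (F k)) else exist _ f0 f0_cocycle.
exists (fun n => sval (F n)); split=> // n x.
by rewrite /= (svalP (step n (F n))).
Qed.

Lemma homotopy_exists (f : forall n, {linear X n -> Y n}) :
  (forall n x, f n.+1 (dX n x) = dY n (f n x)) ->
  (forall x, dX 0%N x = 0 -> f 0%N x = 0) ->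
  exists s : forall n, {linear X n.+1 -> Y n},
    (forall x, f 0%N x = s 0%N (dX 0%N x)) /\
    forall n x, f n.+1 x = dY n (s n x) + s n.+1 (dX n.+1 x).
Proof.
move=> f_chain f_ker.
(* The condition says that [f n.+1 \- (dY n \o s)] vanishes on the image of [dX n], that is on the
   kernel of [dX n.+1]; so it extends along [dX n.+1] to the next component. *)
pose T n := {s : {linear X n.+1 -> Y n} |
  forall x, f n.+1 (dX n x) = dY n (s (dX n x))}.
have step n (s : T n) :
    {t : T n.+1 | forall x, f n.+1 x = dY n (sval s x) + sval t (dX n.+1 x)}.
  apply: cid; case: s => s sE /=.
  have [|t tE] := @injective_extend _ _ _ _ (dX n.+1) (f n.+1 \- (dY n \o s))
      (Y_injective (n := n.+1)).
    by move=> _ /X_exact[x <-] /=; rewrite sE subrr.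
  have tP x : f n.+2 (dX n.+1 x) = dY n.+1 (t (dX n.+1 x)).
    by rewrite f_chain tE /= linearB /= Y_complex subr0.
  by exists (exist _ t tP) => x /=; rewrite tE /= addrC subrK.
have [s0 s0E] := injective_extend (Y_injective (n := 0%N)) f_ker.
have s0P x : f 1%N (dX 0%N x) = dY 0%N (s0 (dX 0%N x)) by rewrite f_chain s0E.
pose F := fix F n : T n :=
  if n is k.+1 then sval (step k (F k)) else exist _ s0 s0P.
exists (fun n => sval (F n)); split=> [x|n x]; first by rewrite /= s0E.
by rewrite /= (svalP (step n (F n))).
Qed.

End Comparison.

(** * Vanishing in low degrees and independence of the resolution *)

Section Vanishing.
Variables (R : comPzRingType) (m : set R).

(** The bound is strict: this expresses that the depth of M is at least n. *)
Definition vanishing (M : lmodType R) (n : nat) : Prop :=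
  forall i, (i < n)%N -> ~ local_cohomology_neq0 m M i.

Lemma torsion_submodule (M : lmodType R) : is_submodule (@torsion R m M).
Proof.
split; first by exists 0%N => a _; rewrite scaler0.
move=> a x y [k xk] [l yl]; exists (maxn k l) => b.
have mon j (j' : nat) c : (j <= j')%N -> ideal_power m j' c -> ideal_power m j c.
  move=> le_jj' [p [e [z [mz ->]]]]; move: z mz.
  rewrite -(subnKC le_jj') => z mz.
  exists p, (fun i => e i * \prod_(i' < j' - j) z i (rshift j i')).
  exists (fun i i' => z i (lshift (j' - j) i')); split=> [i i'|]; first exact: mz.
  by apply: eq_bigr => i _; rewrite big_split_ord /= -mulrA [X in _ * X]mulrC.
move=> bI; rewrite scalerDr scalerA mulrC -scalerA.
rewrite xk ?scaler0 ?add0r ?yl //; apply: mon bI; [exact: leq_maxr|exact: leq_maxl].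
Qed.

Lemma torsion_linear (M N : lmodType R) (u : {linear M -> N}) (x : M) :
  torsion m x -> torsion m (u x).
Proof. by case=> k xk; exists k => a /xk ax; rewrite -linearZ ax linear0. Qed.

Lemma res_diff_comp (M : lmodType R) (E : injective_resolution M) n x :
  res_diff E n.+1 (res_diff E n x) = 0.
Proof.
have : range (res_diff E n) (res_diff E n x) by exists x.
by rewrite res_exactS.
Qed.

Lemma res_diff_exact (M : lmodType R) (E : injective_resolution M) n x :
  res_diff E n.+1 x = 0 -> exists y, res_diff E n y = x.
Proof.
move=> dx; have : [set x | res_diff E n.+1 x = 0] x by [].
by rewrite -res_exactS => -[y _ <-]; exists y.
Qed.

Lemma res_diff_aug (M : lmodType R) (E : injective_resolution M) x :
  res_diff E 0 (res_aug E x) = 0.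
Proof.
have : range (res_aug E) (res_aug E x) by exists x.
by rewrite res_exact0.
Qed.

Lemma res_aug_exact (M : lmodType R) (E : injective_resolution M) x :
  res_diff E 0 x = 0 -> exists y, res_aug E y = x.
Proof.
move=> dx; have : [set x | res_diff E 0 x = 0] x by [].
by rewrite -res_exact0 => -[y _ <-]; exists y.
Qed.

Definition res_vanishing (M : lmodType R) (E : injective_resolution M) n :=
  forall i, (i < n)%N ->
    torsion_cocycles m (E := E) (i := i) `<=`
      torsion_coboundaries m (E := E) (i := i).

Lemma resolution_map (M N : lmodType R) (u : {linear M -> N})
    (E : injective_resolution M) (F : injective_resolution N) :
  exists f : forall n, {linear res_obj E n -> res_obj F n},
    (forall x, f 0%N (res_aug E x) = res_aug F (u x)) /\
    forall n x, f n.+1 (res_diff E n x) = res_diff F n (f n x).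
Proof.
have [x aug0|f0 f0E] := @injective_extend _ _ _ _ (res_aug E) (res_aug F \o u)
    (res_injective (i := F) (n := 0%N)).
  by rewrite -(linear0 (res_aug E)) in aug0; rewrite (res_aug_inj aug0) linear0.
have [x /res_aug_exact[y <-]|f [f0f fE]] := chain_map_exists (@res_diff_exact _ E)
    (@res_diff_comp _ F) (@res_injective _ _ F) (f0 := f0).
  by rewrite f0E res_diff_aug.
by exists f; split=> // x; rewrite f0f f0E.
Qed.

(** Lifts [f], [g] of the identity of M satisfy g f - id = d s + s d. A torsion cocycle x is
    therefore g (f x) - d (s x), where f x is a coboundary; all these maps preserve torsion, being
    linear. *)
Lemma res_vanishing_indep (M : lmodType R) (E F : injective_resolution M) n :
  res_vanishing F n -> res_vanishing E n.
Proof.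
move=> F_van i i_lt x [tx dx].
have [f [f0 fE]] := resolution_map idfun E F.
have [g [g0 gE]] := resolution_map idfun F E.
have [n' x'|x' /res_aug_exact[y <-]|s [s0 sE]] :=
  @homotopy_exists _ _ _ (res_diff E) (res_diff E) (@res_diff_exact _ E)
    (@res_diff_comp _ E) (@res_injective _ _ E) (fun n => (g n \o f n) \- idfun).
- by rewrite /= fE gE linearB.
- by rewrite /= f0 g0 subrr.
have [tfx dfx] : torsion m (f i x) /\ res_diff F i (f i x) = 0.
  by split; [exact: torsion_linear|rewrite -fE dx linear0].
have := F_van i i_lt (f i x) (conj tfx dfx).
case: i x tx dx tfx dfx i_lt => [|i] x tx dx tfx dfx i_lt /=.
  move=> fx0; have := s0 x; rewrite /= fx0 dx !linear0 sub0r => /eqP.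
  by rewrite oppr_eq0 => /eqP.
case=> y ty dy; exists (g i y - s i x).
  apply: submoduleB (torsion_submodule _) _ _ _ _; exact: torsion_linear.
have := sE i x; rewrite /= dx linear0 addr0 -dy gE linearB => <-.
by rewrite opprB addrC subrK.
Qed.

(** Turns a statement about all resolutions into one about a single resolution of one's choice. *)
Lemma vanishingE (M : lmodType R) (E : injective_resolution M) n :
  vanishing M n <-> res_vanishing E n.
Proof.
split=> [M_van i i_lt|E_van i i_lt [F]].
  by apply: contrapT => H; apply: (M_van i i_lt); exists E.
by case; apply: (res_vanishing_indep E_van).
Qed.

Lemma vanishing0 (M : lmodType R) : vanishing M 0.
Proof. by []. Qed.

(** H^0_m(M) is the torsion of M, embedded in degree 0 by [res_aug]. *)
Lemma vanishing_torsion_free (M : lmodType R) n (x : M) :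
  vanishing M n.+1 -> torsion m x -> x = 0.
Proof.
have [E] := resolution_exists M.
move=> /(vanishingE E)/(_ 0%N isT) E_van tx; apply: (@res_aug_inj _ _ E).
rewrite linear0; apply: E_van; split; last exact: res_diff_aug.
exact: torsion_linear.
Qed.

End Vanishing.

(** * Reduction modulo a regular element *)

Lemma injective_prod (R : comPzRingType) (E1 E2 : lmodType R) :
  injective_module E1 -> injective_module E2 ->
  injective_module ((E1 * E2)%type : lmodType R).
Proof.
move=> inj1 inj2 N N' u g u_inj.
have lin1 : linear (fun x => (g x).1) by move=> a x y; rewrite linearP.
have lin2 : linear (fun x => (g x).2) by move=> a x y; rewrite linearP.
have [h1 h1E] := inj1 _ _ u (linear_of lin1) u_inj.
have [h2 h2E] := inj2 _ _ u (linear_of lin2) u_inj.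
have lin : linear (fun x => (h1 x, h2 x)) by move=> a x y; rewrite !linearP.
by exists (linear_of lin) => x /=; rewrite h1E h2E /=; case: (g x).
Qed.

Lemma injective_retract (R : comPzRingType) (K F : lmodType R)
    (p : {linear K -> F}) (s : {linear F -> K}) :
  injective_module K -> (forall y, p (s y) = y) -> injective_module F.
Proof.
move=> K_inj sK N N' u g u_inj; have [h hE] := K_inj _ _ u (s \o g) u_inj.
by exists (p \o h) => x /=; rewrite hE /= sK.
Qed.

Lemma torsion_pair (R : comPzRingType) (m : set R) (M N : lmodType R) (x : M) (y : N) :
  torsion m x -> torsion m y -> torsion m ((x, y) : (M * N)%type).
Proof.
have linl : linear (fun z : M => (z, 0) : M * N).
  by move=> a z t; congr (_, _); rewrite /= scaler0 addr0.
have linr : linear (fun z : N => (0, z) : M * N).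
  by move=> a z t; congr (_, _); rewrite /= scaler0 addr0.
move=> /(torsion_linear (linear_of linl)) tx /(torsion_linear (linear_of linr)) ty.
have -> : (x, y) = linear_of linl x + linear_of linr y.
  by congr (_, _); rewrite /= ?addr0 ?add0r.
exact: (submoduleD (torsion_submodule m _) tx ty).
Qed.

Lemma torsion_fst (R : comPzRingType) (m : set R) (M N : lmodType R) (x : (M * N)%type) :
  torsion m x -> torsion m x.1.
Proof. by case=> k xk; exists k => a /xk; case: x {xk} => x y []. Qed.

Lemma torsion_snd (R : comPzRingType) (m : set R) (M N : lmodType R) (x : (M * N)%type) :
  torsion m x -> torsion m x.2.
Proof. by case=> k xk; exists k => a /xk; case: x {xk} => x y []. Qed.

Section Cone.
Variables (R : comPzRingType) (m : set R) (M Q : lmodType R) (x : R).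
Variable pi : {linear M -> Q}.
Hypothesis x_regular : forall z : M, x *: z = 0 -> z = 0.
Hypothesis pi_surj : forall y, exists z, pi z = y.
Hypothesis pi_ker : forall z, pi z = 0 <-> exists w, z = x *: w.
Variable E : injective_resolution M.

Local Notation d := (res_diff E).

(* The mapping cone of the multiplication by [x] on [E]: since [x] is regular on
   [M], the complex
     res_obj E 0 -> cone_term 0 -> cone_term 1 -> ...
   is exact, except at [cone_term 0], where its cohomology is [M / x M].  Its
   first map splits, so that dividing [cone_term 0] by [res_obj E 0] yields an
   injective resolution of [M / x M]. *)
Definition cone_term n : lmodType R := (res_obj E n.+1 * res_obj E n)%type.

Definition cone_fun n (y : cone_term n) : cone_term n.+1 :=
  (d n.+1 y.1, x *: y.1 - d n y.2).

Lemma cone_fun_linear n : linear (@cone_fun n).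
Proof.
move=> a y z; congr (_, _); first by rewrite /= !linearP.
by rewrite /= scalerDr linearP !scalerDr !scalerA opprD addrACA scalerN [x * a]mulrC.
Qed.

Definition cone_diff n : {linear cone_term n -> cone_term n.+1} :=
  linear_of (@cone_fun_linear n).

Definition cone_iota_fun (e : res_obj E 0) : cone_term 0 := (d 0 e, x *: e).

Lemma cone_iota_linear : linear cone_iota_fun.
Proof.
move=> a y z; congr (_, _); first by rewrite /= linearP.
by rewrite /= scalerDr !scalerA [x * a]mulrC.
Qed.

Definition cone_iota : {linear res_obj E 0 -> cone_term 0} :=
  linear_of cone_iota_linear.

Lemma cone_iota_inj : injective cone_iota.
Proof.
apply: linear_inj => e [/res_aug_exact[z <-]].
rewrite -linearZ -[X in _ = X](linear0 (res_aug E)).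
by move=> /res_aug_inj/x_regular ->; rewrite linear0.
Qed.

Lemma cone_diff_iota e : cone_diff 0 (cone_iota e) = 0.
Proof. by congr (_, _); rewrite /= ?res_diff_comp // linearZ subrr. Qed.

Lemma cone_diff_comp n y : cone_diff n.+1 (cone_diff n y) = 0.
Proof.
congr (_, _); rewrite /= ?res_diff_comp // linearB linearZ /=.
by rewrite res_diff_comp subr0 subrr.
Qed.

Lemma cone_exactS n y : cone_diff n.+1 y = 0 -> exists z, cone_diff n z = y.
Proof.
case: y => a b [/res_diff_exact[a' <-]] /eqP.
rewrite -linearZ -linearB => /eqP/res_diff_exact[b' b'E].
by exists (a', b'); congr (_, _); rewrite /= b'E opprB addrC subrK.
Qed.

Lemma cone_exact0 y : cone_diff 0 y = 0 ->
  exists e z, y = cone_iota e - (0, res_aug E z).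
Proof.
case: y => a b [/res_diff_exact[a' <-]] /eqP.
rewrite -linearZ -linearB => /eqP/res_aug_exact[z zE].
by exists a', z; congr (_, _); rewrite /= ?subr0 // zE opprB addrC subrK.
Qed.

(* [F0] is the cokernel of [cone_iota], [r] a retraction of [cone_iota] and [s]
   the corresponding section of [p]. *)
Variables (F0 : lmodType R) (p : {linear cone_term 0 -> F0}).
Variables (r : {linear cone_term 0 -> res_obj E 0}) (s : {linear F0 -> cone_term 0}).
Hypothesis p_surj : forall y, exists k, p k = y.
Hypothesis p_ker : forall k, p k = 0 <-> range cone_iota k.
Hypothesis s_p : forall k, s (p k) = k - cone_iota (r k).

Lemma cone_ps y : p (s y) = y.
Proof.
have [k <-] := p_surj y; rewrite s_p linearB.
have -> : p (cone_iota (r k)) = 0 by apply/p_ker; exists (r k).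
by rewrite subr0.
Qed.

Definition cone_res_obj n : lmodType R := if n is k.+1 then cone_term k.+1 else F0.

Definition cone_res_diff n : {linear cone_res_obj n -> cone_res_obj n.+1} :=
  match n return {linear cone_res_obj n -> cone_res_obj n.+1} with
  | 0 => cone_diff 0 \o s
  | k.+1 => cone_diff k.+1
  end.

Lemma cone_res_diff0 k : cone_res_diff 0 (p k) = cone_diff 0 k.
Proof. by rewrite -[LHS]/(cone_diff 0 (s (p k))) s_p linearB cone_diff_iota subr0. Qed.

Lemma cone_aug_exists : exists aug : {linear Q -> F0},
  forall z, aug (pi z) = p (0, res_aug E z).
Proof.
have lin : linear (fun z => p (0, res_aug E z)).
  move=> a y z; rewrite -linearP; congr (p _); congr (_, _).
    by rewrite /= scaler0 addr0.
  by rewrite /= linearP.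
have [z /pi_ker[w ->]|aug augE] := @linear_factor _ _ _ _ pi (linear_of lin) pi_surj.
  apply/p_ker; exists (res_aug E w) => //.
  by congr (_, _); rewrite /= ?res_diff_aug // linearZ.
by exists aug.
Qed.

(** The coboundaries are stated with [cone_diff k] also for k = 0, where the resolution has [F0] in
    place of [cone_term 0]. Both give the same coboundaries, because [p] and [s] carry torsion to
    torsion. *)
Lemma cone_resolution_exists : exists F : injective_resolution Q,
  forall n, res_vanishing m F n <->
  (forall i, (i < n)%N ->
    forall y : cone_res_obj i, torsion m y -> cone_res_diff i y = 0 ->
    match i return cone_res_obj i -> Prop with
    | 0 => fun y => y = 0
    | k.+1 => fun y => exists2 z, torsion m z & cone_diff k z = y
    end y).
Proof.
have [aug augE] := cone_aug_exists.
have obj_inj n : injective_module (cone_res_obj n).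
  case: n => [|n]; last by apply: injective_prod; apply: res_injective.
  apply: injective_retract cone_ps.
  by apply: injective_prod; apply: res_injective.
have aug_inj : injective aug.
  apply: linear_inj => y; have [z <-] := pi_surj y; rewrite augE => /p_ker[e _].
  case=> /res_aug_exact[z' <-]; rewrite -linearZ => /res_aug_inj zE.
  by apply/pi_ker; exists z'.
have exact0 : range aug = [set y | cone_res_diff 0 y = 0].
  rewrite predeqE => y; split=> [[q _ <-]|].
    have [z <-] := pi_surj q; rewrite augE /= -[LHS]/(cone_res_diff 0 _) cone_res_diff0.
    by congr (_, _); rewrite /= linear0 // res_diff_aug subr0.
  move=> /= /cone_exact0[e [z yE]]; exists (pi (- z)) => //.
  rewrite augE -[y]cone_ps yE linearB.
  have -> : p (cone_iota e) = 0 by apply/p_ker; exists e.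
  rewrite sub0r -linearN; congr (p _); congr (_, _); first by rewrite /= oppr0.
  by rewrite /= linearN.
have exactS n : range (cone_res_diff n) = [set y | cone_res_diff n.+1 y = 0].
  rewrite predeqE => y; split=> [[z _ <-]|].
    by case: n y z => [|n] y z; apply: cone_diff_comp.
  move=> /cone_exactS[z <-]; case: n z {y} => [|n] z; last by exists z.
  by exists (p z) => //; rewrite cone_res_diff0.
pose F := @InjectiveResolution R Q cone_res_obj aug cone_res_diff
  obj_inj aug_inj exact0 exactS.
exists F => n; split=> F_van i i_lt y.
  move=> ty dy; have := F_van i i_lt y (conj ty dy).
  case: i y i_lt {ty dy} => [|[|i]] y _ //.
  by case=> z tz <-; exists (s z) => //; apply: torsion_linear.
case=> ty dy; have := F_van i i_lt y ty dy.
case: i y i_lt {ty dy} => [|[|i]] y _ //.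
case=> z tz <-; exists (p z); first exact: torsion_linear.
exact: cone_res_diff0.
Qed.

End Cone.

(** Regularity of x makes [cone_iota] injective, so the identity of [res_obj E 0] extends along it
    to [r]; then id - [cone_iota] [r] factors through the cokernel as [s]. *)
Lemma cone_split_exists (R : comPzRingType) (M : lmodType R) (x : R)
    (E : injective_resolution M) :
  (forall z : M, x *: z = 0 -> z = 0) ->
  exists (F0 : lmodType R) (p : {linear cone_term E 0 -> F0})
    (r : {linear cone_term E 0 -> res_obj E 0}) (s : {linear F0 -> cone_term E 0}),
    [/\ forall y, exists k, p k = y, forall k, p k = 0 <-> range (cone_iota x E) k,
        forall e, r (cone_iota x E e) = e & forall k, s (p k) = k - cone_iota x E (r k)].
Proof.
move=> x_regular.
have [F0 [p [p_surj p_ker]]] := quotient_exists (range_submodule (cone_iota x E)).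
have [r rE] := @res_injective _ _ E 0%N _ _ (cone_iota x E) idfun
  (cone_iota_inj x_regular (E := E)).
have [|s sE] := @linear_factor _ _ _ _ p (idfun \- (cone_iota x E \o r)) p_surj.
  by move=> k /p_ker[e _ <-] /=; rewrite rE subrr.
by exists F0, p, r, s.
Qed.

Section ModRegular.
Variables (R : comPzRingType) (m : set R) (M Q : lmodType R) (x : R).
Variable pi : {linear M -> Q}.
Hypothesis mx : m x.
Hypothesis x_regular : forall z : M, x *: z = 0 -> z = 0.
Hypothesis pi_surj : forall y, exists z, pi z = y.
Hypothesis pi_ker : forall z, pi z = 0 <-> exists w, z = x *: w.

Lemma ideal_power_exp k : ideal_power m k (x ^+ k).
Proof.
exists 1%N, (fun _ => 1), (fun _ _ => x); split=> //.
by rewrite big_ord1 mul1r prodr_const card_ord.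
Qed.

(** The long exact sequence of multiplication by x, read off the cone. Forward, H^i(M/xM) sits
    between H^i(M) and H^(i+1)(M). Backward, H^(i-1)(M/xM) = 0 makes x injective on H^i(M), where
    every element is killed by a power of x because x lies in m. *)
Lemma vanishing_mod_regular n : vanishing m M n.+1 <-> vanishing m Q n.
Proof.
have [E] := resolution_exists M.
have [F0 [p [r [s [p_surj p_ker r_iota s_p]]]]] := cone_split_exists E x_regular.
have [F FP] := cone_resolution_exists m pi_surj pi_ker p_surj p_ker s_p.
rewrite (vanishingE m E) (vanishingE m F) FP {FP}.
split=> [E_van i i_lt y ty dy|F_van i].
  (* For a cocycle (a, b) of the cone, a = d a' because H^(k+1)(M) = 0; then x a' - b is a cocycle,
     hence a coboundary because H^k(M) = 0. *)
  have cocycle k (a : res_obj E k.+1) (b : res_obj E k) : (k < n)%N ->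
      torsion m a -> torsion m b -> cone_diff x E k (a, b) = 0 ->
      exists a', [/\ torsion m a', res_diff E k a' = a &
                     torsion_coboundaries m (x *: a' - b)].
    move=> k_lt ta tb [da] db.
    have [a' ta' a'E] := E_van k.+1 k_lt a (conj ta da).
    exists a'; split=> //; apply: E_van; first exact: ltnW.
    split; last by rewrite /= linearB linearZ /= a'E.
    apply: submoduleB tb; first exact: torsion_submodule.
    by apply: submoduleZ => //; apply: torsion_submodule.
  case: i y i_lt ty dy => [|i] y i_lt ty dy.
    have ts : torsion m (s y) by apply: torsion_linear.
    have dsy : cone_diff x E 0 (s y) = 0 by [].
    rewrite -(cone_ps p_surj p_ker s_p y).
    case: (s y) dsy ts => a b dab ts.
    have [a' [ta' a'E /= /eqP]] :=
      cocycle 0%N a b i_lt (torsion_fst ts) (torsion_snd ts) dab.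
    rewrite subr_eq0 => /eqP bE; rewrite -bE -a'E.
    by apply/p_ker; exists a'.
  case: y ty dy => a b ty dy.
  have [a' [ta' a'E [b' tb' b'E]]] :=
    cocycle i.+1 a b i_lt (torsion_fst ty) (torsion_snd ty) dy.
  exists (a', b'); first exact: torsion_pair.
  by congr (_, _); rewrite //= b'E opprB addrC subrK.
move=> i_lt c [tc dc]; have [k ck] := tc.
have {ck} := ck _ (ideal_power_exp k).
(* Peeling off one factor x at a time, it suffices that c is a coboundary whenever x c is. *)
elim: k c tc dc => [|k IHk] c tc dc.
  rewrite expr0 scale1r => ->; case: (i) => [//|j].
  by exists 0; rewrite ?linear0 //; apply: submodule0 (torsion_submodule _ _).
rewrite exprSr -scalerA => /IHk.
have txc : torsion m (x *: c) by apply: submoduleZ tc; apply: torsion_submodule.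
rewrite linearZ /= dc scaler0 => /(_ txc erefl).
case: i c i_lt tc dc {IHk txc} => [|i] c i_lt tc dc /=.
  have [z <-] := res_aug_exact dc; rewrite -linearZ.
  rewrite -[X in _ = X](linear0 (res_aug E)) => /res_aug_inj/x_regular ->.
  by rewrite linear0.
case=> b tb bE.
(* Since x c = d b, the pair (c, b) is a cocycle of the cone, one degree below c. *)
have dcb : cone_diff x E i (c, b) = 0 by congr (_, _); rewrite //= bE subrr.
have tcb : torsion m ((c, b) : cone_term E i) by apply: torsion_pair.
(* In cone degree 0 the resolution has [F0]: vanishing puts (c, b) in the image of [cone_iota], with
   preimage [r (c, b)]. *)
case: i c b i_lt tc dc tb bE dcb tcb => [|i] c b i_lt tc dc tb bE dcb tcb.
  have pcb0 : p (c, b) = 0.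
    apply: (F_van 0%N i_lt (p (c, b))); first exact: torsion_linear.
    by rewrite (cone_res_diff0 s_p).
  exists (r (c, b)); first exact: torsion_linear.
  have := s_p (c, b); rewrite pcb0 linear0 => /(congr1 fst) /= /eqP.
  by rewrite eq_sym subr_eq0 => /eqP.
have [[a' b'] tz [<- _]] := F_van i.+1 i_lt (c, b) tcb dcb.
by exists a' => //; apply: torsion_fst tz.
Qed.

End ModRegular.

(** * Noetherian modules *)

Section Span.
Variables (R : comPzRingType) (M : lmodType R).

Fixpoint spanned (s : seq M) : set M :=
  if s is g :: t then [set x | exists a, spanned t (x - a *: g)] else [set 0].

Lemma spanned_submodule s : is_submodule (spanned s).
Proof.
elim: s => [|g s [IH0 IHs]] /=; first by split=> // a x y -> ->; rewrite scaler0 addr0.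
split; first by exists 0; rewrite scale0r subr0.
move=> a x y [b xb] [c yc]; exists (a * b + c).
have -> : a *: x + y - (a * b + c) *: g = a *: (x - b *: g) + (y - c *: g).
  by rewrite scalerBr scalerA scalerDl opprD addrACA.
exact: IHs.
Qed.

Lemma spanned_cons g s : spanned s `<=` spanned (g :: s).
Proof. by move=> x sx; exists 0; rewrite scale0r subr0. Qed.

Lemma spanned_head g s : spanned (g :: s) g.
Proof. by exists 1; rewrite scale1r subrr; apply: submodule0 (spanned_submodule s). Qed.

Lemma mem_spanned g s : g \in s -> spanned s g.
Proof.
elim: s => // h s IHs; rewrite inE => /orP[/eqP->|/IHs]; first exact: spanned_head.
exact: spanned_cons.
Qed.

Lemma spanned_sub s (S : set M) : is_submodule S -> (forall g, g \in s -> S g) ->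
  spanned s `<=` S.
Proof.
move=> S_sub; elim: s => [_ x -> /=|g s IHs sS x [a xa]]; first exact: submodule0.
rewrite -[x](subrK (a *: g)); apply: (submoduleD S_sub).
  by apply: IHs xa => h hs; apply: sS; rewrite inE hs orbT.
by apply: submoduleZ => //; apply: sS; rewrite mem_head.
Qed.

Definition noetherian_module : Prop :=
  forall S : set M, is_submodule S -> exists s, S = spanned s.

(** For S inside the span of [g :: s], the coefficients of g in elements of S form an ideal. Lifts
    to S of its generators, together with generators of the intersection of S with the span of s,
    generate S. *)
Lemma spanned_noetherian s : noetherian R -> forall S : set M, is_submodule S ->
  S `<=` spanned s -> exists t, S = spanned t.
Proof.
move=> R_noeth; elim: s => [|g s IHs] S S_sub S_le.
  exists nil; rewrite predeqE => x; split=> [/S_le//|->]; exact: submodule0.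
pose I : set R := [set a | exists2 x, S x & spanned s (x - a *: g)].
have s_sub := spanned_submodule s.
have I_ideal : is_ideal I.
  split.
  - by exists 0; [exact: submodule0|rewrite scale0r subr0; exact: submodule0].
  - move=> a b [x Sx xa] [y Sy yb]; exists (x + y); first exact: submoduleD.
    by rewrite scalerDl opprD addrACA; apply: submoduleD.
  - move=> a b [x Sx xb]; exists (a *: x); first exact: submoduleZ.
    by rewrite -scalerA -scalerBr; apply: submoduleZ.
have [n [c IE]] := R_noeth I I_ideal.
have c_I i : I (c i).
  rewrite IE; exists (fun j => (j == i)%:R).
  rewrite (bigD1 i) //= eqxx mul1r big1 ?addr0 // => j /negPf->.
  by rewrite mul0r.
pose y i := s2val (cid2 (c_I i)).
have Sy i : S (y i) by rewrite /y; case: cid2.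
have yc i : spanned s (y i - c i *: g) by rewrite /y; case: cid2.
have [||t tE] := IHs (S `&` spanned s).
- split; first by split; apply: submodule0.
  move=> a u v [Su su] [Sv sv].
  by split; [case: S_sub => _; apply|case: s_sub => _; apply].
- by move=> x [].
exists ([seq y i | i <- enum 'I_n] ++ t); rewrite predeqE => x; split=> [Sx|].
  have [a xa] := S_le x Sx.
  have : I a by exists x.
  rewrite IE => -[b aE].
  have w_sub := spanned_submodule ([seq y i | i <- enum 'I_n] ++ t).
  have t_le : spanned t `<=` spanned ([seq y i | i <- enum 'I_n] ++ t).
    by apply: spanned_sub => // u ut; apply: mem_spanned; rewrite mem_cat ut orbT.
  pose z := \sum_(i < n) b i *: y i.
  have wz : spanned ([seq y i | i <- enum 'I_n] ++ t) z.
    apply: big_ind => [|u v|i _]; [exact: submodule0|exact: submoduleD|].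
    apply: submoduleZ => //; apply: mem_spanned; rewrite mem_cat; apply/orP; left.
    by apply: map_f; rewrite mem_enum.
  rewrite -[x](subrK z); apply: submoduleD => //; apply: t_le; rewrite -tE; split.
    apply: submoduleB => //; apply: big_ind => [|u v|i _].
    - exact: submodule0.
    - exact: submoduleD.
    - exact: submoduleZ.
  have -> : x - z = (x - a *: g) - (z - a *: g) by rewrite opprB addrA subrK.
  apply: submoduleB => //; rewrite aE scaler_suml -sumrB.
  apply: big_ind => [|u v|i _]; [exact: submodule0|exact: submoduleD|].
  by rewrite -scalerA -scalerBr; apply: submoduleZ.
apply: (spanned_sub S_sub) => u; rewrite mem_cat => /orP[/mapP[i _ ->]//|ut].
suff : (S `&` spanned s) u by case.
by rewrite tE; apply: mem_spanned.
Qed.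

Lemma finitely_generated_spanned :
  finitely_generated M -> exists s, forall x, spanned s x.
Proof.
case=> n [g gP]; exists [seq g i | i <- enum 'I_n] => x; have [c ->] := gP x.
have sub := spanned_submodule [seq g i | i <- enum 'I_n].
apply: big_ind => [|u v|i _]; [exact: submodule0|exact: submoduleD|].
by apply: submoduleZ => //; apply: mem_spanned; apply: map_f; rewrite mem_enum.
Qed.

Lemma finitely_generated_noetherian :
  noetherian R -> finitely_generated M -> noetherian_module.
Proof.
move=> R_noeth /finitely_generated_spanned[s sP] S S_sub.
by apply: (spanned_noetherian (s := s)).
Qed.

(** The union of a nonempty chain is spanned by finitely many elements, which all lie in one member;
    so the union is that member. Zorn's lemma applies. *)
Lemma noetherian_module_max (F : set (set M)) : noetherian_module ->
  (forall S, F S -> is_submodule S) -> F !=set0 ->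
  exists S, F S /\ forall T, F T -> S `<=` T -> T = S.
Proof.
move=> M_noeth F_sub [S0 FS0].
pose P S := S = set0 \/ F S.
have [C CP C_tot|S [PS S_max]] := @Zorn_bigcup _ P; last first.
  have FS : F S.
    case: PS => // S_0; case: (S_max S0); last by right.
    rewrite S_0; split; first by move=> x [].
    by move=> /(_ _ (submodule0 (F_sub _ FS0))).
  exists S; split=> // T FT ST; apply: contrapT => TS.
  apply: (S_max T); last by right.
  by split=> // TS'; apply: TS; rewrite eqEsubset.
have [[T [CT T_neq0]]|no] := pselect (exists T, C T /\ T <> set0); last first.
  left; rewrite predeqE => x; split=> // -[T CT Tx]; case: no; exists T; split=> // T0.
  by rewrite T0 in Tx.
right; pose U := \bigcup_(S in C) S; rewrite -/U.
have C_F S x : C S -> S x -> F S.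
  by move=> /CP[S_0 Sx|//]; rewrite S_0 in Sx.
have join x y : U x -> U y -> exists S, [/\ C S, S x & S y].
  move=> [S CS Sx] [S' CS' S'y].
  by case: (C_tot _ _ CS CS') => le; [exists S'|exists S]; split=> //; apply: le.
have U_sub : is_submodule U.
  split; first by exists T => //; apply: submodule0; apply: F_sub; case: (CP _ CT).
  move=> a x y Ux Uy; have [S [CS Sx Sy]] := join x y Ux Uy; exists S => //.
  by have [_] := F_sub _ (C_F _ _ CS Sx); apply.
have [s sE] := M_noeth U U_sub.
have [S [CS FS sS]] : exists S, [/\ C S, F S & forall g, g \in s -> S g].
  have : forall g, g \in s -> U g by move=> g gs; rewrite sE; apply: mem_spanned.
  elim: (s) => [_|g t IHt sU]; first by exists T; split=> //; case: (CP _ CT).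
  have [|S [CS FS tS]] := IHt; first by move=> h ht; apply: sU; rewrite inE ht orbT.
  have [S' CS' S'g] := sU g (mem_head _ _); have FS' := C_F _ _ CS' S'g.
  case: (C_tot _ _ CS CS') => le; [exists S'|exists S]; split=> // h;
    rewrite inE => /orP[/eqP->|/tS] //; exact: le.
suff -> : U = S by [].
rewrite eqEsubset; split; last by move=> x Sx; exists S.
by rewrite sE; apply: spanned_sub => //; apply: F_sub.
Qed.

End Span.

Lemma spanned_map (R : comPzRingType) (M N : lmodType R) (u : {linear M -> N}) s x :
  spanned s x -> spanned (map u s) (u x).
Proof.
elim: s x => [|g s IHs] x /=; first by move=> ->; rewrite linear0.
by case=> a /IHs; rewrite linearB linearZ => ?; exists a.
Qed.

Lemma noetherian_module_surj (R : comPzRingType) (M N : lmodType R)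
    (u : {linear M -> N}) :
  (forall y, exists x, u x = y) -> noetherian_module M -> noetherian_module N.
Proof.
move=> u_surj M_noeth S S_sub.
have [|s sE] := M_noeth (u @^-1` S).
  split; first by rewrite /= linear0; apply: submodule0.
  by move=> a x y Sx Sy; rewrite /= linearP; case: S_sub => _; apply.
exists (map u s); rewrite eqEsubset; split=> [y|].
  have [x <-] := u_surj y => Sx; apply: spanned_map.
  by rewrite -sE.
apply: spanned_sub => // _ /mapP[x xs ->].
by suff : (u @^-1` S) x by []; rewrite sE; apply: mem_spanned.
Qed.

Lemma ideal_submodule (R : comPzRingType) (I : set R) :
  is_ideal I -> is_submodule (I : set R^o).
Proof. by case=> I0 ID IM; split=> // a x y Ix Iy; apply/ID/Iy/IM. Qed.

Lemma finitely_generated_ring (R : comPzRingType) :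
  finitely_generated (R^o : lmodType R).
Proof.
exists 1%N, (fun _ => 1) => x; exists (fun _ => x).
by rewrite big_ord1 -[RHS]/(x * 1) mulr1.
Qed.

Lemma noetherian_ring_module (R : comPzRingType) :
  noetherian R -> noetherian_module (R^o : lmodType R).
Proof.
by move=> R_noeth; apply: finitely_generated_noetherian (finitely_generated_ring R).
Qed.

Lemma noetherian_module_ring (R : comPzRingType) :
  noetherian_module (R^o : lmodType R) -> noetherian R.
Proof.
move=> R_noeth I /ideal_submodule/R_noeth[s ->].
have gen (n : nat) (g : 'I_n -> R) : is_submodule (generated_ideal g : set R^o).
  split; first by exists (fun _ => 0); rewrite big1 // => i _; rewrite mul0r.
  move=> a _ _ [c ->] [e ->]; exists (fun i => a * c i + e i).
  rewrite -[_ *: _]/(a * _) mulr_sumr -big_split; apply: eq_bigr => i _.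
  by rewrite mulrDl mulrA.
exists (size s), (fun i => s`_i); rewrite eqEsubset; split.
  apply: (@spanned_sub _ (R^o : lmodType R) s _ (gen _ _)) => g gs.
  have lt_s : (index g s < size s)%N by rewrite index_mem.
  exists (fun j => (j == Ordinal lt_s)%:R).
  rewrite (bigD1 (Ordinal lt_s)) //= eqxx mul1r big1 ?addr0 ?nth_index //.
  by move=> j /negPf->; rewrite mul0r.
move=> _ [c ->]; have sub := spanned_submodule s.
apply: big_ind => [|u v|i _]; [exact: (submodule0 sub)|exact: (submoduleD sub)|].
by apply: (submoduleZ sub); apply: mem_spanned; apply: mem_nth.
Qed.

Lemma finitely_generated_prod (R : comPzRingType) (M N : lmodType R) :
  finitely_generated M -> finitely_generated N ->
  finitely_generated ((M * N)%type : lmodType R).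
Proof.
move=> [n [g gP]] [k [h hP]].
exists (n + k)%N, (fun i =>
  match fintype.split i with inl j => (g j, 0) | inr j => (0, h j) end).
case=> x y; have [c ->] := gP x; have [e ->] := hP y.
exists (fun i => match fintype.split i with inl j => c j | inr j => e j end).
rewrite big_split_ord /=.
under [X in _ = X + _]eq_bigr => i _ do rewrite (unsplitK (inl _ i)).
under [X in _ = _ + X]eq_bigr => i _ do rewrite (unsplitK (inr _ i)).
have -> : \sum_(i < n) c i *: ((g i, 0) : M * N) = (\sum_(i < n) c i *: g i, 0).
  apply: (big_ind2 (fun (a : M * N) b => a = (b, 0))) => [|_ a _ b -> ->|i _] //.
    by congr (_, _); rewrite /= addr0.
  by congr (_, _); rewrite /= scaler0.
have -> : \sum_(i < k) e i *: ((0, h i) : M * N) = (0, \sum_(i < k) e i *: h i).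
  apply: (big_ind2 (fun (a : M * N) b => a = (0, b))) => [|_ a _ b -> ->|i _] //.
    by congr (_, _); rewrite /= addr0.
  by congr (_, _); rewrite /= scaler0.
by congr (_, _); rewrite /= ?addr0 ?add0r.
Qed.

(** * Associated primes and zero divisors *)

Definition annihilator (R : comPzRingType) (M : lmodType R) (z : M) : set R :=
  [set a | a *: z = 0].

Lemma annihilator_ideal (R : comPzRingType) (M : lmodType R) (z : M) :
  is_ideal (annihilator z).
Proof.
split; first by rewrite /annihilator /= scale0r.
  by move=> a b az bz; rewrite /annihilator /= scalerDl az bz addr0.
by move=> a b bz; rewrite /annihilator /= -scalerA bz scaler0.
Qed.

Lemma prime_annihilator_neq0 (R : comPzRingType) (M : lmodType R) (z : M) :
  prime_ideal (annihilator z) -> z <> 0.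
Proof. by case=> _ n1 _ z0; apply: n1; rewrite /annihilator /= z0 scaler0. Qed.

(** Take a maximal one among the annihilators of the nonzero multiples of z, say that of a z. If y a
    z is nonzero, its annihilator contains that of a z, hence equals it. *)
Lemma prime_annihilator_exists (R : comPzRingType) (M : lmodType R) (z : M) :
  noetherian R -> z <> 0 -> exists a, prime_ideal (annihilator (a *: z)).
Proof.
move=> R_noeth z_neq0.
pose F := [set I : set R^o | exists a, a *: z <> 0 /\ I = annihilator (a *: z)].
have [||_ [[a [az_neq0 ->]] a_max]] := noetherian_module_max (F := F)
    (noetherian_ring_module R_noeth).
- by move=> _ [a [_ ->]]; apply/ideal_submodule/annihilator_ideal.
- by exists (annihilator (1 *: z)), 1; rewrite scale1r.
exists a; split; first exact: annihilator_ideal.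
  by rewrite /annihilator /= scale1r.
move=> x y xyz; have [yz|yz] := pselect (y *: (a *: z) = 0); [by right|left].
rewrite -(a_max (annihilator (y *: (a *: z)))).
- by rewrite /annihilator /= scalerA.
- by exists (y * a); rewrite -scalerA.
- by move=> b bz; rewrite /annihilator /= scalerA mulrC -scalerA bz scaler0.
Qed.

(** If [P t1] contains some [P t2], drop t2. Otherwise some x in I avoids the primes of the tail; if
    x lies in [P t1], it is corrected by a p, with a in I outside [P t1], and p in all primes of the
    tail but not in [P t1]. *)
Lemma prime_avoidance (R : comPzRingType) (T : eqType) (P : T -> set R)
    (I : set R) (s : seq T) :
  is_ideal I -> (forall t, t \in s -> prime_ideal (P t)) ->
  (forall t, t \in s -> exists2 a, I a & ~ P t a) ->
  exists2 x, I x & forall t, t \in s -> ~ P t x.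
Proof.
case=> I0 ID IM; have [n] := ubnP (size s).
elim: n s => // n IHn [|t1 s] /= size_s P_prime I_not; first by exists 0.
have in_s t : t \in s -> t \in t1 :: s by rewrite inE orbC => ->.
have [[t2 [t2s Pt2]]|no] := pselect (exists t, t \in s /\ P t `<=` P t1).
  have in_rem t : t \in t1 :: rem t2 s -> t \in t1 :: s.
    by rewrite !inE => /orP[->//|/mem_rem->]; rewrite orbT.
  have [|||x Ix xP] := IHn (t1 :: rem t2 s).
  - rewrite /= size_rem //; case: (s) t2s size_s => //.
  - by move=> t /in_rem/P_prime.
  - by move=> t /in_rem/I_not.
  exists x => // t; rewrite inE => /orP[/eqP->|ts]; first by apply: xP; rewrite mem_head.
  have [->|t_neq] := eqVneq t t2; first by move=> /Pt2; apply: xP; rewrite mem_head.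
  by apply: xP; rewrite inE (rem_mem t_neq) ?orbT.
have [|t /in_s/P_prime //|t /in_s/I_not //|x Ix xP] := IHn s; first by [].
have [xt1|xt1] := pselect (P t1 x); last first.
  by exists x => // t; rewrite inE => /orP[/eqP->//|/xP].
have [a Ia at1] := I_not t1 (mem_head _ _).
(* No [P t] of the tail lies in [P t1]; p is a product of elements witnessing this, and [P t1] is
   prime. *)
have [p ps pt1] : exists2 p, (forall t, t \in s -> P t p) & ~ P t1 p.
  have [_ t1_proper t1_prime] := P_prime t1 (mem_head _ _).
  have : forall t, t \in s -> exists2 b, P t b & ~ P t1 b.
    move=> t ts; apply: contrapT => nb; apply: no; exists t; split=> // b Pb.
    by apply: contrapT => b1; apply: nb; exists b.
  have : forall t, t \in s -> is_ideal (P t) by move=> t /in_s/P_prime[].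
  elim: (s) => [_ _|t u IHu P_id Pb]; first by exists 1.
  have [||p pu pt1] := IHu.
  - by move=> t' t'u; apply: P_id; rewrite inE t'u orbT.
  - by move=> t' t'u; apply: Pb; rewrite inE t'u orbT.
  have [b tb bt1] := Pb t (mem_head _ _).
  exists (b * p); last by move=> /t1_prime[].
  move=> t'; rewrite inE => /orP[/eqP->|t'u].
    by have [_ _] := P_id t (mem_head _ _); rewrite mulrC; apply.
  have [|_ _] := P_id t'; first by rewrite inE t'u orbT.
  by apply; apply: pu.
exists (x + a * p); first by apply: ID => //; rewrite mulrC; apply: IM.
have sub (Q : set R) c e : is_ideal Q -> Q (c + e) -> Q c -> Q e.
  move=> [_ QD QM] Qce Qc; rewrite -[e](addKr c) addrC; apply: QD => //.
  by rewrite -mulN1r; apply: QM.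
move=> t; rewrite inE => /orP[/eqP->|ts] Pt.
  have [id1 _ t1_prime] := P_prime t1 (mem_head _ _).
  by have /t1_prime[] := sub _ _ _ id1 Pt xt1.
have [idt _ _] := P_prime t (in_s t ts).
apply: (xP t ts); apply: (sub _ (a * p)) => //; first by rewrite addrC.
by case: idt => _ _; apply; apply: ps.
Qed.

(* The zero divisors on a noetherian module form a finite union of annihilators
   that are prime ideals: a submodule that is maximal among those for which this
   holds meets every nonzero submodule. *)
Lemma zero_divisors_finite (R : comPzRingType) (M : lmodType R) :
  noetherian R -> noetherian_module M ->
  exists s : seq M, (forall z, z \in s -> prime_ideal (annihilator z)) /\
    forall a (w : M), w <> 0 -> a *: w = 0 -> exists2 z, z \in s & a *: z = 0.
Proof.
move=> R_noeth M_noeth.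
pose F := [set N : set M | is_submodule N /\ exists s : seq M,
  (forall z, z \in s -> prime_ideal (annihilator z)) /\
  forall a (w : M), N w -> w <> 0 -> a *: w = 0 -> exists2 z, z \in s & a *: z = 0].
have [||N [[N_sub [s [s_prime sN]]] N_max]] := noetherian_module_max (F := F) M_noeth.
- by move=> N [].
- exists [set 0]; split; first by split=> // a x y -> ->; rewrite scaler0 addr0.
  by exists nil; split=> // a w ->.
exists s; split=> // a w w_neq0 aw.
suff [b Nbw bw_neq0] : exists2 b, N (b *: w) & b *: w <> 0.
  by apply: (sN a) Nbw bw_neq0 _; rewrite scalerA mulrC -scalerA aw scaler0.
apply: contrapT => no.
have Nw0 b : N (b *: w) -> b *: w = 0.
  by move=> Nbw; apply: contrapT => bw; apply: no; exists b.
have [c c_prime] := prime_annihilator_exists R_noeth w_neq0.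
pose y := c *: w; have y_neq0 := prime_annihilator_neq0 c_prime.
(* [N'] is N + R y. Once it belongs to the family, maximality puts y in N, although y is a nonzero
   multiple of w. *)
pose N' := [set x | exists b, N (x - b *: y)].
have N'y : N' y by exists 1; rewrite scale1r subrr; apply: submodule0.
have NN' : N `<=` N' by move=> x Nx; exists 0; rewrite scale0r subr0.
suff FN' : F N' by apply/y_neq0/Nw0; rewrite -(N_max N').
split.
  split; first by apply: NN'; apply: submodule0.
  move=> b u v [e Nu] [e' Nv]; exists (b * e + e').
  have -> : b *: u + v - (b * e + e') *: y = b *: (u - e *: y) + (v - e' *: y).
    by rewrite scalerBr scalerA scalerDl opprD addrACA.
  by case: N_sub => _; apply.
exists (y :: s); split=> [z|b x [e Nx] x_neq0 bx].
  by rewrite inE => /orP[/eqP->|/s_prime].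
pose n := x - e *: y; have xE : x = n + e *: y by rewrite subrK.
(* This element equals - b n, so it lies in N and is a multiple of w: it vanishes by [Nw0]. *)
have bey : b *: (e *: y) = 0.
  rewrite /y !scalerA; apply: Nw0; rewrite -!scalerA -/y.
  have -> : b *: (e *: y) = - (b *: n) by rewrite /n scalerBr bx sub0r opprK.
  by apply: submoduleN => //; apply: submoduleZ.
have bn : b *: n = 0 by rewrite /n scalerBr bx bey subr0.
have [n0|n_neq0] := pselect (n = 0); last first.
  by have [z zs bz] := sN b n Nx n_neq0 bn; exists z; rewrite // inE zs orbT.
exists y; first exact: mem_head.
have [_ _ /(_ b e)[]//] := c_prime; first by rewrite /annihilator /= -scalerA.
by rewrite /annihilator /= -/y => ey; case: x_neq0; rewrite xE n0 ey addr0.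
Qed.

(** Finitely many prime annihilators cover the zero divisors. Either one of them contains I, or
    prime avoidance finds an element of I outside all of them. *)
Lemma regular_or_annihilated (R : comPzRingType) (M : lmodType R) (I : set R) :
  noetherian R -> noetherian_module M -> is_ideal I ->
  (exists2 x, I x & forall z : M, x *: z = 0 -> z = 0) \/
  (exists2 z : M, z <> 0 & forall a, I a -> a *: z = 0).
Proof.
move=> R_noeth M_noeth I_ideal.
have [s [s_prime sP]] := zero_divisors_finite R_noeth M_noeth.
have [[z [zs Iz]]|no] := pselect (exists z, z \in s /\ forall a, I a -> a *: z = 0).
  by right; exists z => //; apply: prime_annihilator_neq0; apply: s_prime.
left; have [z zs|x Ix xP] := prime_avoidance I_ideal s_prime.
  apply: contrapT => nz; apply: no; exists z; split=> // a Ia.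
  by apply: contrapT => az; apply: nz; exists a.
exists x => // z xz; apply: contrapT => z_neq0.
by have [y ys] := sP x z z_neq0 xz; apply: xP.
Qed.

(** * Depth and chains of primes *)

Lemma maximal_ideal_exists (R : comPzRingType) (I : set R) :
  is_ideal I -> ~ I 1 -> exists2 m, maximal_ideal m & I `<=` m.
Proof.
move=> I_ideal I1.
pose P (X : set R) := X = set0 \/ [/\ is_ideal X, ~ X 1 & I `<=` X].
have [C CP C_tot|m [Pm m_max]] := @Zorn_bigcup _ P.
  have [[X0 [CX0 X0_neq0]]|no] := pselect (exists X, C X /\ X <> set0); last first.
    left; rewrite predeqE => x; split=> // -[X CX Xx]; case: no; exists X; split=> // X0.
    by rewrite X0 in Xx.
  have good X x : C X -> X x -> [/\ is_ideal X, ~ X 1 & I `<=` X].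
    by move=> /CP[X_0|//]; rewrite X_0.
  have [[_ _ _] _ IX0] : [/\ is_ideal X0, ~ X0 1 & I `<=` X0] by case: (CP _ CX0).
  right; split; last by move=> x /IX0 X0x; exists X0.
    split.
    - by exists X0 => //; apply: IX0; case: I_ideal.
    - move=> x y [X CX Xx] [Y CY Yy].
      have [Z [CZ Zx Zy]] : exists Z, [/\ C Z, Z x & Z y].
        by case: (C_tot _ _ CX CY) => le; [exists Y|exists X]; split=> //; apply: le.
      by exists Z => //; have [[_ ZD _] _ _] := good Z x CZ Zx; apply: ZD.
    - move=> a x [X CX Xx]; exists X => //.
      by have [[_ _ XM] _ _] := good X x CX Xx; apply: XM.
  by case=> X CX X1; have [] := good X 1 CX X1.
have Im0 : I 0 by case: I_ideal.
have [m_ideal m1 Im] : [/\ is_ideal m, ~ m 1 & I `<=` m].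
  case: Pm => // m0; case: (m_max I); last by right; split.
  rewrite m0; split; first by move=> x [].
  by move=> /(_ 0 Im0).
exists m => //; split=> // X X_ideal mX X1; apply: contrapT => Xm.
case: (m_max X); last by right; split=> // x /Im/mX.
by split=> // Xm'; apply: Xm; rewrite eqEsubset.
Qed.

Lemma principal_ideal (R : comPzRingType) (a : R) : is_ideal (range ( *%R a)).
Proof.
split; first by exists 0; rewrite ?mulr0.
  by move=> _ _ [b _ <-] [c _ <-]; exists (b + c); rewrite ?mulrDr.
by move=> b _ [c _ <-]; exists (b * c); rewrite // mulrCA.
Qed.

Lemma unit_notin_maximal (R : comPzRingType) (a : R) :
  (forall m : set R, maximal_ideal m -> ~ m a) -> exists b, a * b = 1.
Proof.
move=> a_max; apply: contrapT => a_unit.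
have [[b _ ab]|m m_max am] := maximal_ideal_exists (principal_ideal a).
  by apply: a_unit; exists b.
by apply: (a_max m m_max); apply: am; exists 1; rewrite ?mulr1.
Qed.

Lemma local_unit (R : comPzRingType) (m : set R) (a : R) :
  local_ring m -> ~ m a -> exists b, a * b = 1.
Proof. by move=> [_ m_uniq] ma; apply: unit_notin_maximal => m' /m_uniq ->. Qed.

Section Ideal.
Variables (R : comPzRingType) (I : set R).
Hypothesis I_ideal : is_ideal I.

Lemma is_ideal0 : I 0. Proof. by case: I_ideal. Qed.
Lemma is_idealD x y : I x -> I y -> I (x + y).
Proof. by case: I_ideal => _ + _; apply. Qed.
Lemma is_idealMl a x : I x -> I (a * x).
Proof. by case: I_ideal => _ _; apply. Qed.
Lemma is_idealMr a x : I x -> I (x * a).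
Proof. by rewrite mulrC; apply: is_idealMl. Qed.
Lemma is_idealN x : I x -> I (- x).
Proof. by rewrite -mulN1r; apply: is_idealMl. Qed.
Lemma is_idealDr x y : I x -> I (x + y) -> I y.
Proof.
by move=> Ix Ixy; rewrite -[y](addKr x); apply: is_idealD Ixy; apply: is_idealN.
Qed.

End Ideal.

Lemma annihilated_torsion (R : comPzRingType) (m : set R) (M : lmodType R) (z : M) :
  is_ideal m -> (forall a, m a -> a *: z = 0) -> torsion m z.
Proof.
move=> m_ideal mz; exists 1%N => _ [k [a [y [my ->]]]]; apply: mz.
apply: big_ind => [|u v|i _]; [exact: is_ideal0|exact: is_idealD|].
by rewrite big_ord1; apply: is_idealMl.
Qed.

Lemma quotient_by_scalar (R : comPzRingType) (M : lmodType R) (x : R) :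
  exists (Q : lmodType R) (pi : {linear M -> Q}),
    (forall y, exists z, pi z = y) /\ (forall z, pi z = 0 <-> exists w, z = x *: w).
Proof.
apply: quotient_exists; split; first by exists 0; rewrite scaler0.
move=> a _ _ [y ->] [z ->]; exists (a *: y + z).
by rewrite scalerDr !scalerA mulrC.
Qed.

Section Depth.
Variables (A : comPzRingType) (m : set A).
Hypotheses (A_noeth : noetherian A) (A_local : local_ring m).

Let m_ideal : is_ideal m. Proof. by case: A_local => -[]. Qed.

(* Nakayama's lemma for the submodule of [M] that is annihilated by [P]: it is
   not contained in [x M], since it would then be equal to [x] times itself. *)
Lemma prime_annihilator_mod_regular (M Q : lmodType A) (x : A)
    (pi : {linear M -> Q}) (z : M) :
  noetherian_module M -> m x -> (forall z : M, x *: z = 0 -> z = 0) ->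
  (forall z, pi z = 0 <-> exists w, z = x *: w) ->
  prime_ideal (annihilator z) ->
  exists y : Q, prime_ideal (annihilator y) /\ annihilator z `<` annihilator y.
Proof.
move=> M_noeth mx x_reg pi_ker z_prime.
(* With P the annihilator of z, an element of N outside x M is enough: its image is killed by P and
   by x, while x is not in P because x z = 0 would force z = 0. *)
pose N := [set w : M | forall a, annihilator z a -> a *: w = 0].
suff [w Nw piw_neq0] : exists2 w, N w & pi w <> 0.
  have [b b_prime] := prime_annihilator_exists A_noeth piw_neq0.
  exists (b *: pi w); split=> //; split=> [a az|].
    rewrite /annihilator /= scalerA mulrC -scalerA -[a *: pi w]linearZ.
    by rewrite (Nw a az) linear0 scaler0.
  move=> /(_ x); case: z_prime => z_ideal z1 _ xz.
  have z0 : z = 0.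
    apply/x_reg/xz; rewrite /annihilator /= scalerA mulrC -scalerA -[x *: pi w]linearZ.
    have -> : pi (x *: w) = 0 by apply/pi_ker; exists w.
    exact: scaler0.
  by apply: z1; rewrite /annihilator /= z0 scaler0.
apply: contrapT => no.
have N_div w : N w -> exists2 v, N v & w = x *: v.
  move=> Nw; have [v wv] : exists v, w = x *: v.
    by apply/pi_ker; apply: contrapT => piw; apply: no; exists w.
  exists v => // a az; apply: x_reg.
  by rewrite scalerA mulrC -scalerA -wv; apply: Nw.
(* Take R w maximal among the nonzero cyclic submodules of N and write w = x v with v in N. Then R v
   = R w, so v = a x v; as 1 - a x is a unit, v = 0. *)
pose F := [set S : set M | exists w, [/\ N w, w <> 0 & S = spanned [:: w]]].
have [||_ [[w [Nw w_neq0 ->]] w_max]] := noetherian_module_max (F := F) M_noeth.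
- by move=> _ [w [_ _ ->]]; apply: spanned_submodule.
- exists (spanned [:: z]), z; split=> //.
  exact: prime_annihilator_neq0 z_prime.
have [v Nv wv] := N_div w Nw.
have v_neq0 : v <> 0 by move=> v0; apply: w_neq0; rewrite wv v0 scaler0.
have : spanned [:: w] v.
  rewrite -(w_max (spanned [:: v])); first exact: spanned_head.
    by exists v.
  move=> t [a]; rewrite /= => /eqP; rewrite subr_eq0 => /eqP ->.
  by rewrite wv scalerA; exists (a * x); rewrite subrr.
case=> a /eqP; rewrite subr_eq0 wv scalerA => /eqP vE.
have [|b ab] := @local_unit _ _ (1 - a * x) A_local.
  move=> m1; case: A_local => -[_ + _] _; apply.
  by rewrite -[1](subrK (a * x)); apply: is_idealD => //; apply: is_idealMl.
apply: v_neq0; rewrite -[v]scale1r -ab mulrC -scalerA scalerBl scale1r -vE.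
by rewrite subrr scaler0.
Qed.

Lemma vanishing_regular (M : lmodType A) n : noetherian_module M ->
  vanishing m M n.+1 -> exists2 x, m x & forall z : M, x *: z = 0 -> z = 0.
Proof.
move=> M_noeth M_van.
have [//|[z z_neq0 mz]] := regular_or_annihilated A_noeth M_noeth m_ideal.
by case: z_neq0; apply: (vanishing_torsion_free M_van); apply: annihilated_torsion.
Qed.

(** Fixing the first prime is what the induction needs: a chain for M/xM that starts at the
    annihilator of y is prolonged downwards by that of z. *)
Lemma vanishing_prime_chain_from n (M : lmodType A) (z : M) :
  noetherian_module M -> vanishing m M n -> prime_ideal (annihilator z) ->
  exists P, prime_chain n P /\ P 0%N = annihilator z.
Proof.
elim: n M z => [|n IHn] M z M_noeth M_van z_prime.
  by exists (fun=> annihilator z); split.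
have [x mx x_reg] := vanishing_regular M_noeth M_van.
have [Q [pi [pi_surj pi_ker]]] := quotient_by_scalar M x.
have [y [y_prime zy]] := prime_annihilator_mod_regular M_noeth mx x_reg pi_ker z_prime.
have [||//|P [[P_prime P_lt] P0]] := IHn Q y.
- exact: noetherian_module_surj pi_surj M_noeth.
- by apply/(vanishing_mod_regular mx x_reg pi_surj pi_ker).
exists (fun i => if i is k.+1 then P k else annihilator z); split=> //.
by split=> -[|i] //= i_lt; [apply: P_prime|rewrite P0|apply: P_lt].
Qed.

Lemma vanishing_prime_chain n (M : lmodType A) (z : M) :
  noetherian_module M -> z <> 0 -> vanishing m M n ->
  exists P : nat -> set A, prime_chain n P.
Proof.
move=> M_noeth z_neq0 M_van.
have [a a_prime] := prime_annihilator_exists A_noeth z_neq0.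
by have [P [P_chain _]] := vanishing_prime_chain_from M_noeth M_van a_prime; exists P.
Qed.

End Depth.

(** * Vanishing under restriction of scalars *)

Section ChangeOfRings.
Variables (A R : comPzRingType) (phi : {rmorphism A -> R}) (m : set A) (n : set R).
Hypotheses (A_noeth : noetherian A) (R_noeth : noetherian R).
Hypotheses (m_ideal : is_ideal m) (n_ideal : is_ideal n).
Hypothesis mn : forall a, m a -> n (phi a).
Hypothesis n_nilp : forall I : set R, is_ideal I -> (forall a, m a -> I (phi a)) ->
  forall y, n y -> exists l, I (y ^+ l).

Lemma regular_exp (M : lmodType R) (y : R) l :
  (forall z : M, y *: z = 0 -> z = 0) -> forall z : M, y ^+ l *: z = 0 -> z = 0.
Proof.
move=> y_reg; elim: l => [|l IHl] z; first by rewrite expr0 scale1r.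
by rewrite exprS -scalerA => /y_reg/IHl.
Qed.

(** [theta] is an isomorphism over A, carried as a function since the two sides are modules over
    different rings. For k > 0, if m has an element regular on N1 * N2, everything is divided by it.
    If not, both sides fail: m kills some nonzero z, and every element of n is nilpotent modulo the
    annihilator of the preimage x of z, so n has no element regular on M and kills some nonzero
    w. *)
Lemma vanishing_restrict_prod k (M : lmodType R) (N1 N2 : lmodType A)
    (theta : M -> (N1 * N2)%type) :
  noetherian_module M -> noetherian_module ((N1 * N2)%type : lmodType A) ->
  {morph theta : x y / x - y} -> (forall a x, theta (phi a *: x) = a *: theta x) ->
  injective theta -> (forall y, exists x, theta x = y) ->
  vanishing n M k <-> vanishing m N1 k /\ vanishing m N2 k.
Proof.
elim: k M N1 N2 theta => [|k IHk] M N1 N2 theta M_noeth N_noeth thB thZ th_inj th_surj.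
  by split.
have th0 := zmod_morphism0 thB.
have [[a ma a_reg]|[z z_neq0 mz]] := regular_or_annihilated A_noeth N_noeth m_ideal.
  have a_reg1 (y : N1) : a *: y = 0 -> y = 0.
    move=> ay; suff [//] : (y, 0 : N2) = 0.
    by apply: a_reg; congr (_, _) => //=; rewrite scaler0.
  have a_reg2 (y : N2) : a *: y = 0 -> y = 0.
    move=> ay; suff [//] : (0 : N1, y) = 0.
    by apply: a_reg; congr (_, _) => //=; rewrite scaler0.
  have a_reg0 (x : M) : phi a *: x = 0 -> x = 0.
    by move=> ax; apply: th_inj; rewrite th0; apply: a_reg; rewrite -thZ ax th0.
  have [Q [pi [pi_surj pi_ker]]] := quotient_by_scalar M (phi a).
  have [Q1 [pi1 [pi1_surj pi1_ker]]] := quotient_by_scalar N1 a.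
  have [Q2 [pi2 [pi2_surj pi2_ker]]] := quotient_by_scalar N2 a.
  rewrite (vanishing_mod_regular (mn ma) a_reg0 pi_surj pi_ker).
  rewrite (vanishing_mod_regular ma a_reg1 pi1_surj pi1_ker).
  rewrite (vanishing_mod_regular ma a_reg2 pi2_surj pi2_ker).
  have q_lin : linear (fun y : (N1 * N2)%type => (pi1 y.1, pi2 y.2)).
    by move=> b x y; congr (_, _); rewrite /= linearP.
  pose q := linear_of q_lin.
  have q_ker (y : N1 * N2) : q y = 0 -> exists w, y = a *: w.
    case: y => y1 y2 [/pi1_ker[w1 ->] /pi2_ker[w2 ->]].
    by exists (w1, w2).
  pose s y := sval (cid (pi_surj y)).
  have sK y : pi (s y) = y by rewrite /s; case: cid.
  (* [theta] descends to the quotients; [thE] says that the choice of representatives does not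
     matter. *)
  pose theta' y := q (theta (s y)).
  have thE x : theta' (pi x) = q (theta x).
    apply/eqP; rewrite -subr_eq0 -linearB -thB.
    have [|w ->] := (pi_ker (s (pi x) - x)).1; first by rewrite linearB sK subrr.
    rewrite thZ; apply/eqP; congr (_, _).
      by apply/pi1_ker; exists (theta w).1.
    by apply/pi2_ker; exists (theta w).2.
  apply: (IHk _ _ _ theta').
  - exact: noetherian_module_surj pi_surj M_noeth.
  - apply: (noetherian_module_surj (u := q)) N_noeth => -[y1 y2].
    have [x1 <-] := pi1_surj y1; have [x2 <-] := pi2_surj y2.
    by exists (x1, x2).
  - move=> x y; rewrite -[x in LHS]sK -[y in LHS]sK -linearB thE thB.
    exact: linearB.
  - move=> b x; rewrite -[x in LHS]sK -linearZ thE thZ.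
    exact: linearZ.
  - move=> x y; rewrite -[x]sK -[y]sK !thE => /eqP.
    rewrite -subr_eq0 -linearB -thB => /eqP/q_ker[w wE].
    have [v vE] := th_surj w; rewrite -vE -thZ in wE.
    apply/eqP; rewrite -subr_eq0 -linearB (th_inj _ _ wE); apply/eqP/pi_ker.
    by exists v.
  - case=> y1 y2; have [x1 <-] := pi1_surj y1; have [x2 <-] := pi2_surj y2.
    by have [x xE] := th_surj (x1, x2); exists (pi x); rewrite thE xE.
split=> [M_van|[N1_van N2_van]]; last first.
  case: z_neq0; case: z mz => z1 z2 mz; congr (_, _).
    apply: (vanishing_torsion_free N1_van); apply: annihilated_torsion => // a ma.
    by case: (mz a ma).
  apply: (vanishing_torsion_free N2_van); apply: annihilated_torsion => // a ma.
  by case: (mz a ma).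
have [x xE] := th_surj z.
have x_neq0 : x <> 0 by move=> x0; apply: z_neq0; rewrite -xE x0 th0.
have mx a : m a -> annihilator x (phi a).
  by move=> ma; apply: th_inj; rewrite thZ xE mz.
have [[y ny y_reg]|[w w_neq0 nw]] := regular_or_annihilated R_noeth M_noeth n_ideal.
  have [l /(regular_exp y_reg)] := n_nilp (annihilator_ideal x) mx ny.
  by [].
case: w_neq0; apply: (vanishing_torsion_free M_van).
exact: annihilated_torsion.
Qed.

End ChangeOfRings.

(** * Integral extensions *)

Lemma noetherian_module_restrict (A R : comPzRingType) (phi : {rmorphism A -> R})
    (M : lmodType R) (N : lmodType A) (theta : M -> N) :
  {morph theta : x y / x - y} -> (forall a x, theta (phi a *: x) = a *: theta x) ->
  injective theta -> (forall y, exists x, theta x = y) ->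
  noetherian_module N -> noetherian_module M.
Proof.
move=> thB thZ th_inj th_surj N_noeth S S_sub.
have th0 := zmod_morphism0 thB.
have thD := zmod_morphismD thB.
pose psi y := sval (cid (th_surj y)).
have psiK y : theta (psi y) = y by rewrite /psi; case: cid.
have span_psi s x : spanned s (theta x) -> spanned (map psi s) x.
  elim: s x => [|g s IHs] x /=; first by rewrite -th0 => /th_inj.
  by case=> a ya; exists (phi a); apply: IHs; rewrite thB thZ psiK.
have [|s sE] := N_noeth (theta @` S).
  split; first by exists 0; [exact: submodule0|].
  move=> a _ _ [x Sx <-] [y Sy <-]; exists (phi a *: x + y); last by rewrite thD thZ.
  by case: S_sub => _; apply.
exists (map psi s); rewrite eqEsubset; split=> [x Sx|].
  by apply: span_psi; rewrite -sE; exists x.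
apply: spanned_sub => // _ /mapP[y ys ->].
have [x Sx <-] : (theta @` S) y by rewrite sE; apply: mem_spanned.
by rewrite (th_inj _ x (psiK _)).
Qed.

Section Integral.
Variables (A R : comPzRingType) (phi : {rmorphism A -> R}).

(* Values at [y] of the polynomials of degree less than [n], resp. of the monic
   polynomials of degree [n], with coefficients in [A], by Horner's rule. *)
Fixpoint poly_value (n : nat) (y : R) : set R :=
  if n is k.+1 then [set v | exists w a, poly_value k y w /\ v = y * w + phi a]
  else [set 0].

Fixpoint monic_value (n : nat) (y : R) : set R :=
  if n is k.+1 then [set v | exists w a, monic_value k y w /\ v = y * w + phi a]
  else [set 1].

Lemma poly_value_combination n y a u v : poly_value n y u -> poly_value n y v ->
  poly_value n y (phi a * u + v).
Proof.
elim: n u v => [|n IHn] u v /=; first by move=> -> ->; rewrite mulr0 addr0.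
move=> [w [b [nw ->]]] [x [c [nx ->]]]; exists (phi a * w + x), (a * b + c).
split; first exact: IHn.
by rewrite !mulrDr rmorphD rmorphM mulrCA addrACA.
Qed.

Lemma poly_value0 n y : poly_value n y 0.
Proof. by elim: n => //= n IHn; exists 0, 0; rewrite mulr0 rmorph0 addr0. Qed.

Lemma poly_valueS n y : poly_value n y `<=` poly_value n.+1 y.
Proof.
elim: n => [|n IHn] v; first by move=> ->; apply: poly_value0.
by case=> w [a [nw ->]]; exists w, a; split=> //; apply: IHn.
Qed.

Lemma poly_value_exp n y : poly_value n.+1 y (y ^+ n).
Proof.
elim: n => [|n IHn]; first by exists 0, 1; rewrite mulr0 rmorph1 add0r.
by exists (y ^+ n), 0; rewrite rmorph0 addr0 -exprS.
Qed.

Lemma poly_value_monic n y v : poly_value n y v -> monic_value n y (y ^+ n - v).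
Proof.
elim: n v => [|n IHn] v /=; first by move=> ->; rewrite subr0.
case=> w [a [/IHn nw ->]]; exists (y ^+ n - w), (- a); split=> //.
by rewrite mulrBr -exprS rmorphN opprD addrA.
Qed.

(** The A-submodules generated by 1, y, ..., y^(n-1) embed in the noetherian module N, so their
    increasing sequence has a maximal term. It contains y^n, which gives a monic equation. *)
Lemma integral_exists (N : lmodType A) (theta : R -> N) :
  {morph theta : x y / x - y} -> (forall a x, theta (phi a * x) = a *: theta x) ->
  injective theta -> noetherian_module N ->
  forall y, exists n, monic_value n y 0.
Proof.
move=> thB thZ th_inj N_noeth y.
have th0 := zmod_morphism0 thB.
have thD := zmod_morphismD thB.
pose F := [set S | exists n, S = theta @` poly_value n y].
have [||_ [[n ->] n_max]] := noetherian_module_max (F := F) N_noeth.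
- move=> _ [n ->]; split; first by exists 0; [exact: poly_value0|].
  move=> a _ _ [u nu <-] [v nv <-]; exists (phi a * u + v); last by rewrite thD thZ.
  exact: poly_value_combination.
- by exists (theta @` poly_value 0 y), 0%N.
have : (theta @` poly_value n y) (theta (y ^+ n)).
  rewrite -(n_max (theta @` poly_value n.+1 y)).
  - by exists (y ^+ n) => //; apply: poly_value_exp.
  - by exists n.+1.
  - by move=> _ [u nu <-]; exists u => //; apply: poly_valueS.
case=> v nv /th_inj vE; exists n.
by rewrite -[0](subrr (y ^+ n)) -{2}vE; apply: poly_value_monic.
Qed.

Hypothesis integral : forall y, exists n, monic_value n y 0.

(** Let y be in Q but not in P. In a Horner value y w + phi a that lies in P, the constant phi a
    lies in Q, hence in P; so w lies in P. Descending from the monic equation ends with 1 in P. *)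
Lemma incomparability (P Q : set R) : prime_ideal P -> prime_ideal Q ->
  P `<=` Q -> (forall a, Q (phi a) -> P (phi a)) -> Q `<=` P.
Proof.
move=> [P_ideal P1 P_prime] [Q_ideal Q1 Q_prime] PQ QP y Qy.
apply: contrapT => Py; have [n ny] := integral y.
have : P 0 by apply: is_ideal0.
elim: n 0 ny => [|n IHn] v /=; first by move=> ->.
case=> w [a [nw ->]] Pv; apply: (IHn w nw).
have Pa : P (phi a).
  by apply: QP; apply: (is_idealDr Q_ideal) (PQ _ Pv); apply: is_idealMr.
rewrite addrC in Pv.
by have /P_prime[] := is_idealDr P_ideal Pa Pv.
Qed.

Lemma prime_preimage (S T : comPzRingType) (g : {rmorphism S -> T}) (P : set T) :
  prime_ideal P -> prime_ideal (g @^-1` P).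
Proof.
move=> [P_ideal P1 P_prime]; split; last by move=> x y; rewrite /= rmorphM => /P_prime.
  split; first by rewrite /= rmorph0; apply: is_ideal0.
    by move=> x y Px Py; rewrite /= rmorphD; apply: is_idealD.
  by move=> a x Px; rewrite /= rmorphM; apply: is_idealMl.
by rewrite /= rmorph1.
Qed.

Lemma prime_chain_contract n (P : nat -> set R) :
  prime_chain n P -> prime_chain n (fun i => phi @^-1` P i).
Proof.
move=> [P_prime P_lt]; split=> i i_le; first exact/prime_preimage/P_prime.
have [sub nsub] := P_lt i i_le; split=> [a|le]; first exact: sub.
apply: nsub; apply: incomparability (P_prime i (ltnW i_le)) (P_prime _ i_le) sub _.
by move=> a; apply: le.
Qed.

Lemma prime_chain_pullback n (psi : {rmorphism R -> A}) (P : nat -> set A) :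
  (forall a, exists r, psi r = a) ->
  prime_chain n P -> prime_chain n (fun i => psi @^-1` P i).
Proof.
move=> psi_surj [P_prime P_lt]; split=> i i_le; first exact/prime_preimage/P_prime.
have [sub nsub] := P_lt i i_le; split=> [a|le]; first exact: sub.
by apply: nsub => a; have [r <-] := psi_surj a; apply: le.
Qed.

(** Descend along a monic equation of y, keeping y^j v in I for the current Horner value v = y w +
    phi a. If a is in m, then phi a is in I and y^(j+1) w is in I. Otherwise phi a is a unit, so v
    is one too because y is in n, and y^j is in I. *)
Lemma integral_nilpotent (m : set A) (n : set R) :
  local_ring m -> local_ring n ->
  forall I : set R, is_ideal I -> (forall a, m a -> I (phi a)) ->
  forall y, n y -> exists l, I (y ^+ l).
Proof.
move=> A_local R_local I I_ideal mI y ny.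
have [[n_ideal n1 _] _] := R_local.
have [k ky] := integral y.
have : I (y ^+ 0 * 0) by rewrite mulr0; apply: is_ideal0.
elim: k 0 ky 0%N => [|k IHk] v /=; first by move=> -> j; rewrite mulr1; exists j.
case=> w [a [kw ->]] j Iv.
have [ma|ma] := pselect (m a).
  apply: (IHk w kw j.+1); rewrite exprSr -mulrA.
  apply: (is_idealDr I_ideal (x := y ^+ j * phi a)).
    by apply: is_idealMl => //; apply: mI.
  by rewrite -mulrDr addrC.
have [b ab] := local_unit A_local ma.
have [|c wc] := @local_unit _ _ (y * w + phi a) R_local.
  move=> /(is_idealDr n_ideal (is_idealMr n_ideal w ny)) na.
  by apply: n1; rewrite -(rmorph1 phi) -ab rmorphM; apply: is_idealMr.
by exists j; rewrite -[_ ^+ _]mulr1 -wc mulrA; apply: is_idealMr.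
Qed.

End Integral.

Lemma local_ring_units (R : comPzRingType) (n : set R) :
  is_ideal n -> ~ n 1 -> (forall r, ~ n r -> exists s, r * s = 1) -> local_ring n.
Proof.
move=> n_ideal n1 n_unit.
have le (I : set R) : is_ideal I -> ~ I 1 -> I `<=` n.
  move=> I_ideal I1 r Ir; apply: contrapT => /n_unit[s rs].
  by apply: I1; rewrite -rs; apply: is_idealMr.
split; first by split=> // I I_ideal nI I1; rewrite eqEsubset; split=> //; apply: le.
by move=> m' [m'_ideal m'1 m'_max]; rewrite (m'_max n) //; apply: le.
Qed.

(** * Comparison of depth and dimension *)

Section Supremum.
Local Open Scope ereal_scope.

Lemma supremum_eq (T : set (\bar int)) x : T !=set0 -> supremums T x ->
  supremum -oo T = x.
Proof.
move=> /set0P T_neq0 Tx; rewrite /supremum (negPf T_neq0).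
by case: xgetP => [y _ Ty|/(_ x)//]; apply: (is_subset1_supremums Ty Tx).
Qed.

Lemma infimum_eq (T : set (\bar int)) x : T !=set0 -> infimums T x ->
  infimum +oo T = x.
Proof.
move=> /set0P T_neq0 Tx; rewrite /infimum (negPf T_neq0).
by case: xgetP => [y _ Ty|/(_ x)//]; apply: (is_subset1_infimums Ty Tx).
Qed.

Lemma supremum_nat_max (T : set nat) s : T s -> (forall k, T k -> (k <= s)%N) ->
  supremum -oo [set n%:Z%:E | n in T] = s%:Z%:E.
Proof.
move=> Ts T_le; apply: supremum_eq; first by exists s%:Z%:E, s.
split; first by move=> _ [k Tk <-]; rewrite lee_fin lez_nat; apply: T_le.
by move=> y; apply; exists s.
Qed.

Lemma supremum_nat_unbounded (T : set nat) : (forall s, exists2 k, T k & (s <= k)%N) ->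
  supremum -oo [set n%:Z%:E | n in T] = +oo.
Proof.
move=> T_unb; have [k0 Tk0 _] := T_unb 0%N.
apply: supremum_eq; first by exists k0%:Z%:E, k0.
split; first by move=> _ [k Tk <-]; rewrite leey.
move=> [y||] y_ub //; last by have := y_ub k0%:Z%:E (ex_intro2 _ _ k0 Tk0 erefl).
have [k Tk ky] := T_unb `|y|%N.+1.
have := y_ub k%:Z%:E (ex_intro2 _ _ k Tk erefl); rewrite lee_fin => k_le.
have : (`|y|%N.+1%:Z <= y)%R by apply: le_trans k_le; rewrite lez_nat.
have y_le : (y <= `|y|%N%:Z)%R by rewrite abszE ler_norm.
by move=> /le_trans /(_ y_le); rewrite lez_nat ltnn.
Qed.

End Supremum.

(** The hypothesis says that the depth is at most the dimension, so equality amounts to the reverse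
    inequality, expressed on chains. This covers the case where both are infinite. *)
Lemma depth_eq_krull_dim (R : comPzRingType) (m : set R) (M : lmodType R) :
  (forall k, vanishing m M k -> exists P : nat -> set R, prime_chain k P) ->
  depth m M = krull_dim R <->
  (forall k (P : nat -> set R), prime_chain k P -> vanishing m M k).
Proof.
pose T := [set k | exists P : nat -> set R, prime_chain k P].
move=> van_T; rewrite /depth /krull_dim -/T.
have T0 : T 0%N by apply: van_T; apply: vanishing0.
have [[i0 i0_neq0]|no] := pselect (exists i, local_cohomology_neq0 m M i); last first.
  (* Here the depth is +oo, and [van_T] gives chains of every length, so the dimension is +oo as
     well. *)
  have van k : vanishing m M k by move=> i _ Hi; apply: no; exists i.
  have -> : [set i | local_cohomology_neq0 m M i] = set0.
    by rewrite -subset0 => i Hi; apply: no; exists i.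
  rewrite image_set0 /infimum eqxx supremum_nat_unbounded //.
  by move=> s; exists s => //; apply: van_T.
have ex : exists i, `[< local_cohomology_neq0 m M i >] by exists i0; apply/asboolP.
case: (ex_minnP ex) => s /asboolP s_neq0 s_min.
have vanE k : vanishing m M k <-> (k <= s)%N.
  split=> [M_van|k_le i i_lt i_neq0]; first by rewrite leqNgt; apply/negP => /M_van.
  have := s_min i; rewrite asboolT // => /(_ isT) s_le.
  by have := leq_trans i_lt (leq_trans k_le s_le); rewrite ltnn.
have -> : infimum +oo%E
    [set n%:Z%:E%E | n in [set i | local_cohomology_neq0 m M i]] = s%:Z%:E%E.
  apply: infimum_eq; first by exists s%:Z%:E%E, s.
  split.
    move=> _ [i i_neq0 <-]; rewrite lee_fin lez_nat.
    by apply: s_min; apply/asboolP.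
  by move=> y; apply; exists s.
split=> [|T_le]; last first.
  rewrite (@supremum_nat_max T s) //; first by apply: van_T; apply/vanE.
  by move=> k [P Pk]; apply/vanE/(T_le k P).
move=> sE k P Pk; apply/vanE; rewrite leqNgt; apply/negP => s_lt.
have Tk : T k by exists P.
have [[u u_ub]|unb] := pselect (exists u, forall j, T j -> (j <= u)%N); last first.
  move: sE; rewrite supremum_nat_unbounded // => i.
  apply: contrapT => ni; apply: unb; exists i => j Tj; rewrite leqNgt; apply/negP => i_lt.
  by apply: ni; exists j => //; apply: ltnW.
have exT : exists j, `[< T j >] by exists k; apply/asboolP.
have ubT j : `[< T j >] -> (j <= u)%N by move=> /asboolP/u_ub.
case: (ex_maxnP exT ubT) => t /asboolP Tt t_max.
move: sE; rewrite (@supremum_nat_max T t) //; last first.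
  by move=> j Tj; apply: t_max; apply/asboolP.
move=> [st]; have := t_max k; rewrite asboolT // => /(_ isT).
by rewrite -st leqNgt s_lt.
Qed.

(** * The amalgamation *)

Section Amalgamation.
Variables (A B : comPzRingType) (f : {rmorphism A -> B}) (J : ideal B).

Local Notation R := (amalgamation f J).
Local Notation N := ((A^o * ideal_module f J)%type : lmodType A).

Lemma amalgamation_mk_subproof a j : ideal_set J j ->
  (a, f a + j) \in amalgamation_pred f J.
Proof. by move=> Jj; apply/asboolP; exists a, j. Qed.

Definition amalgamation_mk a j (Jj : ideal_set J j) : R :=
  Amalgamation (amalgamation_mk_subproof a Jj).

Lemma amalgamation_inj (r s : R) : val r = val s -> r = s.
Proof. exact: val_inj. Qed.

Definition amalgamation_fst (r : R) : A := (val r).1.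

Lemma amalgamation_fst_zmod : {morph amalgamation_fst : x y / x - y}.
Proof. by []. Qed.

Lemma amalgamation_fst_monoid : monoid_morphism amalgamation_fst.
Proof. by []. Qed.

HB.instance Definition _ :=
  GRing.isZmodMorphism.Build R A amalgamation_fst amalgamation_fst_zmod.
HB.instance Definition _ :=
  GRing.isMonoidMorphism.Build R A amalgamation_fst amalgamation_fst_monoid.

Definition amalgamation_diag (a : A) : R := amalgamation_mk a (ideal0 J).

Lemma amalgamation_diag_zmod : {morph amalgamation_diag : x y / x - y}.
Proof.
by move=> x y; apply: amalgamation_inj; congr (_, _); rewrite /= !addr0 rmorphB.
Qed.

Lemma amalgamation_diag_monoid : monoid_morphism amalgamation_diag.
Proof.
split=> [|x y]; apply: amalgamation_inj; congr (_, _).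
  by rewrite /= addr0 rmorph1.
by rewrite /= !addr0 rmorphM.
Qed.

HB.instance Definition _ :=
  GRing.isZmodMorphism.Build A R amalgamation_diag amalgamation_diag_zmod.
HB.instance Definition _ :=
  GRing.isMonoidMorphism.Build A R amalgamation_diag amalgamation_diag_monoid.

Lemma amalgamation_fst_surj a : exists r, amalgamation_fst r = a.
Proof. by exists (amalgamation_diag a). Qed.

Lemma amalgamation_snd_subproof (r : R) :
  (val r).2 - f (val r).1 \in ideal_pred J.
Proof.
case: r => r /= /asboolP[a [j [Jj ->]]].
by apply/asboolP; rewrite /= addrC addKr.
Qed.

Definition amalgamation_split (r : R) : N :=
  ((val r).1, IdealElt (amalgamation_snd_subproof r) : ideal_module f J).

Lemma amalgamation_split_zmod : {morph amalgamation_split : x y / x - y}.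
Proof.
move=> x y; congr (_, _); apply: val_inj => /=.
by rewrite rmorphB !opprD addrACA.
Qed.

Lemma amalgamation_split_scale a x :
  amalgamation_split (amalgamation_diag a * x) = a *: amalgamation_split x.
Proof.
congr (_, _); apply: val_inj => /=.
by rewrite addr0 rmorphM mulrBr.
Qed.

Lemma amalgamation_split_inj : injective amalgamation_split.
Proof.
move=> x y [xy1 xy2]; apply: amalgamation_inj.
move: xy2; rewrite xy1 => /addIr xy2.
by rewrite [LHS]surjective_pairing [RHS]surjective_pairing xy1 xy2.
Qed.

Lemma amalgamation_split_surj y : exists x, amalgamation_split x = y.
Proof.
case: y => a [j j_pred]; have /asboolP Jj := j_pred.
exists (amalgamation_mk a Jj); congr (_, _); apply: val_inj => /=.
by rewrite addrC addKr.
Qed.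

Hypothesis A_noeth : noetherian A.
Hypothesis J_fg : finitely_generated (ideal_module f J).

Lemma amalgamation_split_noetherian : noetherian_module N.
Proof.
apply: finitely_generated_noetherian => //.
by apply: finitely_generated_prod J_fg; apply: finitely_generated_ring.
Qed.

Lemma amalgamation_noetherian_module : noetherian_module (R^o : lmodType R).
Proof.
exact: (@noetherian_module_restrict A R amalgamation_diag (R^o : lmodType R) N
  amalgamation_split amalgamation_split_zmod amalgamation_split_scale
  amalgamation_split_inj amalgamation_split_surj amalgamation_split_noetherian).
Qed.

Lemma amalgamation_noetherian : noetherian R.
Proof. exact: noetherian_module_ring amalgamation_noetherian_module. Qed.

Lemma amalgamation_integral y : exists n, monic_value amalgamation_diag n y 0.
Proof.
exact: (@integral_exists A R amalgamation_diag N amalgamation_split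
  amalgamation_split_zmod amalgamation_split_scale amalgamation_split_inj
  amalgamation_split_noetherian).
Qed.

Lemma amalgamation_prime_chain n :
  (exists P : nat -> set R, prime_chain n P) <->
  (exists P : nat -> set A, prime_chain n P).
Proof.
split=> -[P P_chain].
  by eexists; apply: (prime_chain_contract amalgamation_integral P_chain).
by eexists; apply: (prime_chain_pullback amalgamation_fst_surj P_chain).
Qed.

Variable m : set A.
Hypothesis A_local : local_ring m.
Hypothesis J_jacobson : (J : set B) `<=` jacobson_radical B.

Definition amalgamation_maximal : set R := amalgamation_fst @^-1` m.

Let m_ideal : is_ideal m. Proof. by case: A_local => -[]. Qed.

Lemma amalgamation_maximal_ideal : is_ideal amalgamation_maximal.
Proof.
split; first exact: is_ideal0 m_ideal.
  by move=> x y; apply: is_idealD m_ideal _ _.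
by move=> a x; apply: is_idealMl m_ideal _ _.
Qed.

(** Let a be outside m. Then f a is a unit, and since j lies in every maximal ideal of B, f a + j
    lies in none; so both components of (a, f a + j) are units. *)
Lemma amalgamation_local : local_ring amalgamation_maximal.
Proof.
apply: local_ring_units; first exact: amalgamation_maximal_ideal.
  by case: A_local => -[].
case=> r r_pred ma; have /asboolP[a [j [Jj rE]]] := r_pred.
rewrite /amalgamation_maximal /amalgamation_fst /= rE /= in ma.
have [b ab] := local_unit A_local ma.
have fab : f a * f b = 1 by rewrite -rmorphM ab rmorph1.
have [|u ju] := @unit_notin_maximal B (f a + j).
  move=> m' m'_max; have m'j := J_jacobson Jj m'_max.
  have [m'_ideal m'1 _] := m'_max; rewrite addrC => /(is_idealDr m'_ideal m'j) m'a.
  by apply: m'1; rewrite -fab; apply: is_idealMr.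
(* With u the inverse of f a + j and b that of a, u = f b - f b u j; so the inverse pair (b, u)
   belongs to the amalgamation. *)
have Ju : ideal_set J (- (f b * u) * j).
  exact: idealMl.
exists (amalgamation_mk b Ju); apply: amalgamation_inj; congr (_, _).
  by rewrite /= rE.
rewrite /= rE /=.
have -> : f b + - (f b * u) * j = f b * ((f a + j) * u) - f b * (j * u).
  by rewrite ju mulr1 mulNr -mulrA [u * j]mulrC.
by rewrite [(_ + _) * u]mulrDl mulrDr addrK [f b * _]mulrA [f b * f a]mulrC fab mul1r.
Qed.

End Amalgamation.

(** For J = 0 the amalgamation is a copy of A, whereas the zero module has depth +oo; this is the
    case that [J_neq0] excludes. *)
Theorem corollary2p5 (A : comPzRingType) (m : set A) (B : comPzRingType)
    (f : {rmorphism A -> B}) (J : ideal B)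
    (A_noetherian : noetherian A) (A_local : local_ring m)
    (J_jacobson : (J : set B) `<=` jacobson_radical B)
    (J_fg : finitely_generated (ideal_module f J))
    (J_neq0 : (J : set B) <> [set 0]) :
  cohen_macaulay (amalgamation f J) <->
  cohen_macaulay A /\ maximal_cohen_macaulay m (ideal_module f J).
Proof.
pose R_mod : lmodType (amalgamation f J) := (amalgamation f J)^o.
have R_noeth := amalgamation_noetherian A_noetherian J_fg.
have R_local := amalgamation_local f A_local J_jacobson.
have A_mod := noetherian_ring_module A_noetherian.
have J_mod := finitely_generated_noetherian A_noetherian J_fg.
have [[m_ideal m1 _] _] := A_local.
have A_van k : vanishing m (A^o : lmodType A) k ->
    exists P : nat -> set A, prime_chain k P.
  apply: (vanishing_prime_chain A_noetherian A_local (z := (1 : A^o))) => // one0.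
  by apply: m1; rewrite one0; apply: is_ideal0.
have [j j_neq0] : exists j : ideal_module f J, j <> 0.
  apply: contrapT => no; apply: J_neq0; rewrite predeqE => x.
  split=> [Jx|->]; last exact: ideal0.
  have x_pred : x \in ideal_pred J by apply/asboolP.
  apply: contrapT => x_neq0; apply: no; exists (IdealElt x_pred).
  by move=> /(congr1 val).
have J_van k : vanishing m (ideal_module f J) k ->
    exists P : nat -> set A, prime_chain k P.
  exact: (vanishing_prime_chain A_noetherian A_local J_mod j_neq0).
have R_vanE k : vanishing (amalgamation_maximal m) R_mod k <->
    vanishing m (A^o : lmodType A) k /\ vanishing m (ideal_module f J) k.
  exact: (vanishing_restrict_prod A_noetherian R_noeth m_ideal
    (amalgamation_maximal_ideal f J A_local) (phi := amalgamation_diag f J) (fun a ma => ma)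
    (integral_nilpotent (amalgamation_integral A_noetherian J_fg) A_local R_local)
    k (noetherian_ring_module R_noeth) (amalgamation_split_noetherian A_noetherian J_fg)
    (@amalgamation_split_zmod A B f J) (@amalgamation_split_scale A B f J)
    (@amalgamation_split_inj A B f J) (@amalgamation_split_surj A B f J)).
have chainE := amalgamation_prime_chain A_noetherian J_fg.
have R_depth := @depth_eq_krull_dim _ (amalgamation_maximal m) R_mod.
(* That the depth of the amalgamation is at most its dimension is inherited from A: vanishing passes
   to A, and the chain found there is pulled back. *)
have {}R_depth := R_depth (fun k van => (chainE k).2 (A_van k ((R_vanE k).1 van).1)).
have R_chain_van : (forall k (P : nat -> set (amalgamation f J)), prime_chain k P ->
    vanishing (amalgamation_maximal m) R_mod k) <->
    (forall k (P : nat -> set A), prime_chain k P -> vanishing m (A^o : lmodType A) k) /\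
    (forall k (P : nat -> set A), prime_chain k P -> vanishing m (ideal_module f J) k).
  split=> [van|[A_all J_all] k P P_chain].
    by split=> k P P_chain; have [Q /van/R_vanE[]] := (chainE k).2 (ex_intro _ P P_chain).
  have [Q Q_chain] := (chainE k).1 (ex_intro _ P P_chain).
  by apply/R_vanE; split; [apply: A_all Q_chain|apply: J_all Q_chain].
rewrite /maximal_cohen_macaulay (depth_eq_krull_dim J_van).
(* The maximal ideal in [cohen_macaulay] is existentially quantified; locality identifies it with
   m. *)
have -> : cohen_macaulay A <->
    (forall k (P : nat -> set A), prime_chain k P -> vanishing m (A^o : lmodType A) k).
  rewrite -(depth_eq_krull_dim A_van).
  split=> [[_ [m' [m'_local]]]|]; last by split=> //; exists m.
  by case: A_local => _ /(_ m'); case: m'_local => + _ => /[swap]/[apply] ->.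
have -> : cohen_macaulay (amalgamation f J) <->
    depth (amalgamation_maximal m) R_mod = krull_dim (amalgamation f J).
  split=> [[_ [n [n_local]]]|]; last by split=> //; exists (amalgamation_maximal m).
  by case: R_local => _ /(_ n); case: n_local => + _ => /[swap]/[apply] ->.
by rewrite R_depth R_chain_van; split=> [[]|[A_all []]].
Qed.
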